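(* Let $F$ be a differential field of characteristic zero. For every integer $n\ge 1$, we have $\gamma(n)=n$, where $\gamma(n)$ is the minimum number of parameters to which the general $n\times n$ matrix differential equation $\delta(Y)=AY$ over $F$ can be simplified by gauge transformations over $K=F\left(a_{ij}^{(k)} \mid 1\le i,j\le n,\ k\ge 0\right)$.
   Context: A differential field $(F,\delta)$ is a field with a derivation $\delta:F\to F$; all fields have characteristic zero, and a differential field extension is a field extension with compatible derivations. Write $r^{(k)}=\delta^k(r)$. Elements $r_i$ ($i\in I$) of a differential field extension of $F$ are differentially algebraically independent over $F$ if all the elements $r_i^{(k)}$ ($i\in I$, $k\ge 0$) are algebraically independent over $F$. The differential transcendence degree $\operatorname{trdeg}^{\delta}_F K_0$ of a differential field extension $K_0/F$ is the cardinality of a maximal differentially algebraically independent (over $F$) subset of $K_0$. The general $n\times n$ matrix differential equation over $F$ is $\delta(Y)=AY$ where the $n^2$ entries $a_{ij}$ of $A$ are differentially algebraically independent over $F$. Let $K=F\left(a_{ij}^{(k)}\mid 1\le i,j\le n,\ k\ge 0\right)$ be the differential field generated by the entries of $A$ over $F$. Given $n\times n$ matrices $C,D$ over a differential field $L$, the equation $\delta(V)=DV$ is gauge equivalent over $L$ to $\delta(U)=CU$ if there is $P\in \mathrm{GL}_n(L)$ with $D=PCP^{-1}+\delta(P)P^{-1}$ (corresponding to $V=PU$), where $\delta(P)$ is taken entrywise. The number $\gamma(n)$ is the minimum, over all equations $\delta(Z)=BZ$ (with $B$ an $n\times n$ matrix over $K$) gauge equivalent over $K$ to $\delta(Y)=AY$,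 of the number of differentially algebraically independent (over $F$) entries of $B$. Equivalently, $\gamma(n)=\min \operatorname{trdeg}^{\delta}_F K_0$, the minimum being over the differential subfields $K_0$ of $K$ that contain both $F$ and the entries of $B$ for some equation $\delta(Z)=BZ$ gauge equivalent over $K$ to $\delta(Y)=AY$. *)

(* Defs.v *)
From mathcomp Require Import all_boot all_order all_algebra.
From mathcomp Require Import boolp.
From mathcomp Require Import mpoly.

Set Implicit Arguments.
Unset Strict Implicit.
Unset Printing Implicit Defensive.

Import GRing.Theory.
Local Open Scope ring_scope.

Definition derivation (R : nzRingType) (d : R -> R) : Prop :=
  {morph d : x y / x + y} /\ (forall x y, d (x * y) = d x * y + x * d y).

(* A differential field extension is an embedding [iota : F -> K] of fields
   that commutes with the derivations. *)
Definition diff_morphism (F K : nzRingType) (dF : F -> F) (dK : K -> K)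
    (iota : F -> K) : Prop :=
  forall x, iota (dF x) = dK (iota x).

(* Families rather than sets: a family with a repeated value is dependent. The
   index type may be infinite, hence the finite subfamilies [x \o s]. *)
Definition alg_indep (F K : fieldType) (iota : {rmorphism F -> K})
    (J : Type) (x : J -> K) : Prop :=
  forall (m : nat) (s : 'I_m -> J) (p : {mpoly F[m]}),
    injective s -> mmap iota (x \o s) p = 0 -> p = 0.

Definition diff_alg_indep (F K : fieldType) (iota : {rmorphism F -> K})
    (d : K -> K) (I : Type) (r : I -> K) : Prop :=
  alg_indep iota (fun ik : I * nat => iter ik.2 d (r ik.1)).

Definition generated_by (F K : fieldType) (iota : F -> K)
    (J : Type) (x : J -> K) : Prop :=
  forall S : {pred K}, divring_closed S ->
    (forall c, iota c \in S) -> (forall j, x j \in S) -> forall y, y \in S.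

(* [K] is the field F(a_ij^(k)) and the a_ij are independent parameters. This
   determines (K, dK, A) up to isomorphism over (F, dF). *)
Definition general_matrix (F K : fieldType) (iota : {rmorphism F -> K})
    (d : K -> K) (n : nat) (A : 'M[K]_n) : Prop :=
  diff_alg_indep iota d (fun ij : 'I_n * 'I_n => A ij.1 ij.2) /\
  generated_by iota
    (fun ijk : 'I_n * 'I_n * nat => iter ijk.2 d (A ijk.1.1 ijk.1.2)).

Definition gauge_equiv (K : fieldType) (d : K -> K) (n : nat)
    (C D : 'M[K]_n) : Prop :=
  exists2 P : 'M[K]_n, P \in unitmx &
    D = P *m C *m invmx P + map_mx d P *m invmx P.

Definition entries_diff_indep (F K : fieldType) (iota : {rmorphism F -> K})
    (d : K -> K) (n : nat) (B : 'M[K]_n) (S : {set 'I_n * 'I_n}) : Prop :=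
  diff_alg_indep iota d
    (fun u : {ij : 'I_n * 'I_n | ij \in S} => B (val u).1 (val u).2).

Definition num_params (F K : fieldType) (iota : {rmorphism F -> K})
    (d : K -> K) (n : nat) (B : 'M[K]_n) : nat :=
  \max_(S : {set 'I_n * 'I_n} | `[< entries_diff_indep iota d B S >]) #|S|.

Definition is_minimum (P : nat -> Prop) (m : nat) : Prop :=
  P m /\ forall k, P k -> (m <= k)%N.

(* For a general matrix [A], [is_gamma iota d A g] reads gamma(n) = g. *)
Definition is_gamma (F K : fieldType) (iota : {rmorphism F -> K})
    (d : K -> K) (n : nat) (A : 'M[K]_n) (g : nat) : Prop :=
  is_minimum
    (fun m => exists2 B, gauge_equiv d A B & num_params iota d B = m) g.

(* Main.v *)
Require Import Defs.
From mathcomp Require Import all_boot all_order all_algebra.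
From mathcomp Require Import boolp functions mpoly ring zify.

Set Implicit Arguments.
Unset Strict Implicit.
Unset Printing Implicit Defensive.

Import Order.TTheory GRing.Theory Num.Theory.
Local Open Scope ring_scope.

(** The upper bound is the classical passage to a companion matrix by a cyclic
    vector: its entries other than those of the last row are 0 or 1.

    For the lower bound, let [B] be gauge equivalent to [A] by [P]. The vector
    [e1 P] is cyclic for the equation [A], as is in fact every nonzero vector
    of [K^n], so that [e1] is cyclic for [B], and the coefficients
    [b_0, ..., b_(n-1)] of the corresponding companion matrix belong to the
    differential field generated by the entries of [B] over [F]. They are
    differentially independent over [F], whatever [P] is, for the following
    reason. Give the [a_ij] and all their derivatives the degree 1. The
    derivation of [K] preserves degrees, while multiplication by [A] raises
    them by one, so that the leading terms of the vectors
    [v, nabla v, nabla^2 v, ...] are those of [w, w A, w A^2, ...], with [w]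
    the leading form of [v]. Hence [b_i] has degree [n - i], and its leading
    form is, up to sign, a coefficient of the characteristic polynomial of [A]
    ([krylov_unit_leading]), provided that [w] is cyclic for [A]. It is, because
    the generic matrix [A] leaves no proper subspace of [K^n] stable
    ([generic_cyclic]). The coefficients of the characteristic polynomial are
    independent, since companion matrices realise all of their values.

    Independence is measured with differentials. The partial derivatives along
    the generators [a_ij^(k)] extend to [K] ([exists_lin_derivation]) and turn
    differential independence into linear independence over the operators
    [K[d]] in the module of differentials. In characteristic zero linearly
    independent differentials come from algebraically independent elements
    ([jacobian_alg_indep]), and this easy half of the Jacobian criterion
    suffices: the differentials of the [b_i] are shown to be independent by
    leading terms ([companion_row_indep]), they lie in the submodule spanned by
    the differentials of the entries of [B], and a comparison of dimensions
    provides [n] entries of [B] with independent differentials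
    ([op_rank_le]). *)

(** * Derivations *)

Lemma der0 (R : nzRingType) (d : R -> R) (hd : derivation d) : d 0 = 0.
Proof. by apply: (addrI (d 0)); rewrite -hd.1 !addr0. Qed.

Lemma der1 (R : nzRingType) (d : R -> R) (hd : derivation d) : d 1 = 0.
Proof.
by apply: (addrI (d 1)); have := hd.2 1 1; rewrite !mulr1 mul1r addr0 => <-.
Qed.

Lemma derN (R : nzRingType) (d : R -> R) (hd : derivation d) :
  {morph d : x / - x}.
Proof. by move=> x; apply: (addrI (d x)); rewrite -hd.1 !subrr der0. Qed.

Lemma derB (R : nzRingType) (d : R -> R) (hd : derivation d) :
  {morph d : x y / x - y}.
Proof. by move=> x y; rewrite hd.1 derN. Qed.

Lemma der_sum (R : nzRingType) (d : R -> R) (hd : derivation d)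
    (I : Type) (r : seq I) (P : pred I) (f : I -> R) :
  d (\sum_(i <- r | P i) f i) = \sum_(i <- r | P i) d (f i).
Proof. by apply: (big_morph d hd.1); exact: der0. Qed.

Lemma der_bool (R : nzRingType) (d : R -> R) (hd : derivation d) (b : bool) :
  d b%:R = 0.
Proof. by case: b; [exact: der1 | exact: der0]. Qed.

Lemma der_div (K : fieldType) (d : K -> K) (hd : derivation d) (x y : K) :
  y != 0 -> d (x / y) = (d x * y - x * d y) / y ^+ 2.
Proof.
move=> y0; have /(congr1 d) := divfK y0 x; rewrite hd.2 => e.
have -> : d (x / y) = (d x - x / y * d y) / y by rewrite -e addrK mulfK.
by field.
Qed.

Lemma der_mulmx (R : nzRingType) (d : R -> R) (hd : derivation d) m n p
    (A : 'M[R]_(m, n)) (B : 'M[R]_(n, p)) :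
  map_mx d (A *m B) = map_mx d A *m B + A *m map_mx d B.
Proof.
apply/matrixP => i j; rewrite !mxE (der_sum hd) -big_split /=.
by apply: eq_bigr => k _; rewrite !mxE hd.2.
Qed.

(** * The polynomial subring generated by an independent family *)

(** Polynomials in the variables [U] in unevaluated form: they can be evaluated
    in every [F]-algebra without first choosing finitely many variables. *)
Inductive poly_term (F U : Type) : Type :=
  | TConst of F
  | TVar of U
  | TAdd of poly_term F U & poly_term F U
  | TMul of poly_term F U & poly_term F U.
Arguments TConst {F U} _.
Arguments TVar {F U} _.

Fixpoint teval (F U : Type) (E : nzRingType) (j : F -> E) (b : U -> E)
    (t : poly_term F U) : E :=
  match t with
  | TConst c => j c
  | TVar u => b u
  | TAdd t1 t2 => teval j b t1 + teval j b t2
  | TMul t1 t2 => teval j b t1 * teval j b t2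
  end.

Fixpoint tvars (F U : Type) (t : poly_term F U) : seq U :=
  match t with
  | TConst c => [::]
  | TVar u => [:: u]
  | TAdd t1 t2 | TMul t1 t2 => tvars t1 ++ tvars t2
  end.

Lemma teval_mpoly (F : fieldType) (U : eqType) (s : seq U)
    (t : poly_term F U) (ts : {subset tvars t <= s}) :
  exists p : {mpoly F[size s]}, forall (E : comNzRingType)
    (j : {rmorphism F -> E}) (b : U -> E),
    teval j b t = mmap j (b \o tnth (in_tuple s)) p.
Proof.
elim: t ts => [c|u|t1 IH1 t2 IH2|t1 IH1 t2 IH2] /= ts.
- by exists c%:MP => E j b; rewrite mmapC.
- have us : u \in s by apply: ts; rewrite inE.
  have ui : (index u s < size s)%N by rewrite index_mem.
  exists 'X_(Ordinal ui) => E j b; rewrite mmapX mmap1U /=.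
  by rewrite (tnth_nth u) /= nth_index.
- have [|p1 e1] := IH1; first by move=> u ut; apply: ts; rewrite mem_cat ut.
  have [|p2 e2] := IH2; first by move=> u ut; apply: ts; rewrite mem_cat ut orbT.
  by exists (p1 + p2) => E j b; rewrite e1 e2 mmapD.
- have [|p1 e1] := IH1; first by move=> u ut; apply: ts; rewrite mem_cat ut.
  have [|p2 e2] := IH2; first by move=> u ut; apply: ts; rewrite mem_cat ut orbT.
  by exists (p1 * p2) => E j b; rewrite e1 e2 rmorphM.
Qed.

(** The ring generated by an algebraically independent family is a polynomial
    ring: a relation between its elements persists under every substitution. *)
Lemma alg_indep_teval (F K : fieldType) (iota : {rmorphism F -> K})
    (U : eqType) (a : U -> K) (ha : alg_indep iota a)
    (E : comNzRingType) (j : {rmorphism F -> E}) (b : U -> E)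
    (t : poly_term F U) :
  teval iota a t = 0 -> teval j b t = 0.
Proof.
have [|p e] := @teval_mpoly F U (undup (tvars t)) t.
  by move=> u; rewrite mem_undup.
rewrite !e => /ha -> //; first by rewrite mmap0.
by apply/tuple_uniqP; exact: undup_uniq.
Qed.

Lemma generated_by_frac (F K : fieldType) (iota : {rmorphism F -> K})
    (U : eqType) (a : U -> K) (ha : generated_by iota a) (y : K) :
  exists t t', teval iota a t' != 0 /\ y = teval iota a t / teval iota a t'.
Proof.
pose P y := exists t t', teval iota a t' != 0 /\
  y = teval iota a t / teval iota a t'.
suff: y \in [pred y | `[< P y >]] by rewrite inE => /asboolP.
have PC (x : K) : P x <-> x \in [pred y | `[< P y >]].
  by rewrite inE; split=> /asboolP.
apply: ha => [|c|u].
- split=> [|x z /PC [t [t' [t0 ->]]] /PC [s [s' [s0 ->]]]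
    |x z /PC [t [t' [t0 ->]]] /PC [s [s' [s0 ->]]]]; apply/PC.
  + by exists (TConst 1), (TConst 1); rewrite /= rmorph1 oner_neq0 divr1.
  + exists (TAdd (TMul t s') (TMul (TConst (-1)) (TMul s t'))), (TMul t' s').
    by rewrite /= rmorphN1 mulf_neq0 //; split=> //; field; rewrite t0 s0.
  + have [e0|n0] := eqVneq (teval iota a s) 0.
      exists (TConst 0), (TConst 1).
      by rewrite /= rmorph1 oner_neq0 rmorph0 e0 !mul0r invr0 mulr0.
    exists (TMul t s'), (TMul t' s); rewrite /= mulf_neq0 //.
    by split=> //; field; rewrite t0 s0 n0.
- apply/PC; exists (TConst c), (TConst 1).
  by rewrite /= rmorph1 oner_neq0 divr1.
- apply/PC; exists (TVar u), (TConst 1).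
  by rewrite /= rmorph1 oner_neq0 divr1.
Qed.

(** * Derivations of a purely transcendental extension *)

Definition lin_derivation (F K : fieldType) (iota : F -> K) (D : K -> K) :=
  derivation D /\ forall c, D (iota c) = 0.

Fixpoint tder (F U : Type) (E : nzRingType) (j : F -> E) (b m : U -> E)
    (t : poly_term F U) : E :=
  match t with
  | TConst c => 0
  | TVar u => m u
  | TAdd t1 t2 => tder j b m t1 + tder j b m t2
  | TMul t1 t2 => tder j b m t1 * teval j b t2 + teval j b t1 * tder j b m t2
  end.

(** Evaluate at [a + m 'X]: the linear coefficient is [tder]. *)
Lemma alg_indep_tder (F K : fieldType) (iota : {rmorphism F -> K})
    (U : eqType) (a : U -> K) (ha : alg_indep iota a) (m : U -> K)
    (t : poly_term F U) :
  teval iota a t = 0 -> tder iota a m t = 0.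
Proof.
move=> /(alg_indep_teval ha).
move=> /(_ _ (polyC \o iota : {rmorphism F -> _}) (fun u => (a u)%:P + m u *: 'X)).
suff: (teval (polyC \o iota) (fun u => (a u)%:P + m u *: 'X) t)`_0
     = teval iota a t /\
   (teval (polyC \o iota) (fun u => (a u)%:P + m u *: 'X) t)`_1
     = tder iota a m t.
  by case=> _ <- ->; rewrite coef0.
elim: t => [c|u|t1 [e1 f1] t2 [e2 f2]|t1 [e1 f1] t2 [e2 f2]] /=.
- by rewrite !coefC.
- by rewrite !coefD !coefC !coefZ !coefX /= mulr0 mulr1 addr0 add0r.
- by rewrite !coefD e1 e2 f1 f2.
- by rewrite !coefM !big_ord_recr !big_ord0 /= !add0r e1 e2 f1 f2 addrC.
Qed.

Section DerivationExtension.
Variables (F K : fieldType) (iota : {rmorphism F -> K}).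
Variables (U : eqType) (a : U -> K).
Hypothesis ai : alg_indep iota a.
Hypothesis ag : generated_by iota a.
Variable m : U -> K.

Local Notation ev := (teval iota a).
Local Notation dv := (tder iota a m).

Let quot (t t' : poly_term F U) := (dv t * ev t' - ev t * dv t') / ev t' ^+ 2.

Let quot_wd t t' s s' : ev t' != 0 -> ev s' != 0 ->
  ev t / ev t' = ev s / ev s' -> quot t t' = quot s s'.
Proof.
move=> t0 s0 /eqP; rewrite eqr_div // => /eqP e.
have /(alg_indep_tder ai m) /= : ev (TAdd (TMul t s')
    (TMul (TConst (-1)) (TMul s t'))) = 0.
  by rewrite /= rmorphN1 e mulN1r subrr.
rewrite rmorphN1 mul0r add0r mulN1r => d0.
have {}d0 : dv s * ev t' = dv t * ev s' + ev t * dv s' - ev s * dv t'.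
  by apply/eqP; rewrite -subr_eq0 -oppr_eq0 -d0; apply/eqP; ring.
have -> : quot s s' = (dv s * ev t' * ev s' - (ev s * ev t') * dv s')
    / (ev t' * ev s' ^+ 2).
  by rewrite /quot; field; rewrite s0 t0.
rewrite d0 -e.
have -> : (dv t * ev s' + ev t * dv s' - ev s * dv t') * ev s'
    - ev t * ev s' * dv s' = ev s' * (dv t * ev s') - (ev s * ev s') * dv t'.
  by ring.
have -> : ev s = ev t * ev s' / ev t' by rewrite e mulfK.
by rewrite /quot; field; rewrite s0 t0.
Qed.

(** Partial differentiation extends from polynomials to fractions by the
    quotient rule, so an independent generating family can be given arbitrary
    derivatives. *)
Lemma exists_lin_derivation :
  exists2 D, lin_derivation iota D & forall u, D (a u) = m u.
Proof.
have /choice [f fP] (y : K) : exists tt, ev tt.2 != 0 /\ y = ev tt.1 / ev tt.2.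
  by have [t [t' h]] := generated_by_frac ag y; exists (t, t').
pose D y := quot (f y).1 (f y).2.
have DE t t' : ev t' != 0 -> D (ev t / ev t') = quot t t'.
  move=> t0; have [n0 e] := fP (ev t / ev t').
  by apply: quot_wd => //; rewrite -e.
have D1 t : D (ev t) = dv t.
  have := DE t (TConst 1); rewrite /quot /= rmorph1 divr1 => ->.
    by rewrite mulr1 mulr0 subr0 expr1n divr1.
  exact: oner_neq0.
exists D; last by move=> u; rewrite (D1 (TVar u)).
split; last by move=> c; rewrite (D1 (TConst c)).
split=> x y; have [tx xE] := fP x; have [ty yE] := fP y.
  have -> : x + y = ev (TAdd (TMul (f x).1 (f y).2) (TMul (f y).1 (f x).2))
      / ev (TMul (f x).2 (f y).2).
    by rewrite /= {1}xE {1}yE; field; rewrite tx ty.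
  rewrite DE ?mulf_neq0 // /D /quot /=; field.
  by rewrite ty tx.
have -> : x * y = ev (TMul (f x).1 (f y).1) / ev (TMul (f x).2 (f y).2).
  by rewrite /= {1}xE {1}yE; field; rewrite tx ty.
have -> : D x * y + x * D y = D x * (ev (f y).1 / ev (f y).2)
    + ev (f x).1 / ev (f x).2 * D y by rewrite -xE -yE.
rewrite DE ?mulf_neq0 // /D /quot /=; field.
by rewrite ty tx.
Qed.

End DerivationExtension.

Lemma lin_derivation_eq0 (F K : fieldType) (iota : {rmorphism F -> K})
    (U : Type) (a : U -> K) (ag : generated_by iota a) (D : K -> K) :
  lin_derivation iota D -> (forall u, D (a u) = 0) -> forall y, D y = 0.
Proof.
move=> [dD Dc] Da y.
suff: y \in [pred y | D y == 0] by move/eqP.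
apply: ag => [|c|u]; rewrite ?inE ?Dc ?Da //.
split=> [|x z|x z]; rewrite ?inE ?der1 // => /eqP ex /eqP ez.
  by rewrite (derB dD) ex ez subr0.
have [->|z0] := eqVneq z 0; first by rewrite invr0 mulr0 der0.
by rewrite der_div // ex ez mul0r mulr0 subr0 mul0r.
Qed.

(** * Differentials detect algebraic independence *)

Lemma lin_derivation_mmap (F K : fieldType) (iota : {rmorphism F -> K})
    (D : K -> K) (hD : lin_derivation iota D) k (x : 'I_k -> K)
    (p : {mpoly F[k]}) :
  D (mmap iota x p) = \sum_i mmap iota x (mderiv i p) * D (x i).
Proof.
have [dD Dc] := hD.
pose Q (p : {mpoly F[k]}) :=
  D (mmap iota x p) = \sum_i mmap iota x (mderiv i p) * D (x i).
have QC c : Q c%:MP.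
  rewrite /Q mmapC Dc big1 // => i _; by rewrite mderivC mmap0 mul0r.
have QM p1 p2 : Q p1 -> Q p2 -> Q (p1 * p2).
  move=> e1 e2; rewrite /Q rmorphM dD.2 e1 e2 mulr_suml mulr_sumr -big_split /=.
  by apply: eq_bigr => i _; rewrite mderivM mmapD !rmorphM /=; ring.
have QX i : Q 'X_i.
  rewrite /Q mmapX mmap1U (bigD1 i) //= mderivX mnm1E eqxx scale1r.
  rewrite [X in mmap _ _ 'X_[X]](_ : _ = 0%MM) ?mmapX ?mmap11 ?mul1r.
    rewrite big1 ?addr0 // => l li.
    by rewrite mderivX mnm1E eq_sym (negPf li) scale0r mmap0 mul0r.
  by apply/mnmP => l; rewrite mnmBE mnm0E subnn.
rewrite -/(Q p); elim/mpolyind: p => [|c m p _ _ IH]; first by rewrite -mpolyC0.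
have QXm : Q 'X_[m].
  rewrite mpolyXE_id; apply: (big_ind Q) => // [|i _].
    by rewrite -mpolyC1.
  by elim: (m i) => [|l IHl]; rewrite ?expr0 -?mpolyC1 // exprS; apply: QM.
have : Q (c *: 'X_[m]) by rewrite -mul_mpolyC; apply: QM.
rewrite /Q => e; rewrite mmapD dD.1 e IH -big_split /=.
by apply: eq_bigr => i _; rewrite mderivD mmapD mulrDl.
Qed.

Lemma msize_mderiv (F : fieldType) k (i : 'I_k) (p : {mpoly F[k]}) N :
  (msize p <= N.+1)%N -> (msize (mderiv i p) <= N)%N.
Proof.
move=> pN; rewrite msizeE; apply/bigmax_leqP_seq => m mp _.
have: p@_(m + U_(i)) != 0.
  apply: contraTneq mp => e; rewrite mcoeff_msupp mcoeff_deriv e mul0rn.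
  by rewrite eqxx.
rewrite -mcoeff_msupp => /msize_mdeg_lt; rewrite mdegD mdeg1 addn1 => h.
by rewrite -ltnS (leq_trans h).
Qed.

Lemma mderiv_eq0 (F : fieldType) (charF : [pchar F] =i pred0) k
    (p : {mpoly F[k]}) :
  (forall i, mderiv i p = 0) -> p = (p@_0)%:MP.
Proof.
move=> dp; apply/mpolyP => m; rewrite mcoeffC.
have [->|m0] := eqVneq m 0%MM; first by rewrite mulr1.
have [i mi] : exists i, m i != 0%N.
  apply/existsP; apply: contraNT m0; rewrite negb_exists => /forallP h.
  by apply/eqP/mnmP => i; rewrite mnm0E; have := h i; rewrite negbK => /eqP.
have mE : m = (m - U_(i) + U_(i))%MM.
  rewrite submK //; apply/mnm_lepP => l; rewrite mnm1E.
  by case: eqP => // <-; rewrite lt0n.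
have := congr1 (mcoeff (m - U_(i))%MM) (dp i).
rewrite mcoeff_deriv -mE mcoeff0 mulr0 => /eqP.
by rewrite -mulr_natr mulf_eq0 ((pcharf0P _).1 charF) orbF => /eqP.
Qed.

(** A polynomial relation of least degree, once differentiated, is a linear
    relation between the differentials whose coefficients would be relations of
    smaller degree; in characteristic zero they do not all vanish. *)
Lemma jacobian_alg_indep (F K : fieldType) (charF : [pchar F] =i pred0)
    (iota : {rmorphism F -> K}) (U J : Type) (D : U -> K -> K)
    (hD : forall u, lin_derivation iota (D u)) (x : J -> K) :
  (forall k (s : 'I_k -> J) (c : 'I_k -> K), injective s ->
    (forall u, \sum_i c i * D u (x (s i)) = 0) -> forall i, c i = 0) ->
  alg_indep iota x.
Proof.
move=> ind k s p s_inj; have [N] := ubnP (msize p).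
elim: N p => // N IH p; rewrite ltnS => pN p0.
have pC : p = (p@_0)%:MP.
  apply: mderiv_eq0 => // i.
  have {}p0 : mmap iota (x \o s) (mderiv i p) = 0.
    apply: (ind k s (fun i => mmap iota (x \o s) (mderiv i p))) => // u.
    by rewrite -(lin_derivation_mmap (hD u)) p0 der0 //; case: (hD u).
  case: N IH pN => [|N] IH pN.
    by move: pN; rewrite leqn0 msize_poly_eq0 => /eqP ->; rewrite mderiv0.
  by apply: IH => //; rewrite ltnS msize_mderiv.
move: p0; rewrite pC mmapC => /eqP; rewrite fmorph_eq0 => /eqP ->.
by rewrite mpolyC0.
Qed.

(** * Rank over differential operators *)

Section Span.
Variables (K : fieldType) (V : lmodType K).
Implicit Types (s : seq V) (u v w : V).

Definition in_span s v := exists c : 'I_(size s) -> K, v = \sum_i c i *: s`_i.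

Lemma in_span0 s : in_span s 0.
Proof. by exists (fun=> 0); rewrite big1 // => i _; rewrite scale0r. Qed.

Lemma in_spanD s u v : in_span s u -> in_span s v -> in_span s (u + v).
Proof.
move=> [c ->] [c' ->]; exists (fun i => c i + c' i).
by rewrite -big_split; apply: eq_bigr => i _; rewrite scalerDl.
Qed.

Lemma in_spanZ s a v : in_span s v -> in_span s (a *: v).
Proof.
move=> [c ->]; exists (fun i => a * c i).
by rewrite scaler_sumr; apply: eq_bigr => i _; rewrite scalerA.
Qed.

Lemma in_span_sum s (I : Type) (r : seq I) (P : pred I) (f : I -> V) :
  (forall i, P i -> in_span s (f i)) -> in_span s (\sum_(i <- r | P i) f i).
Proof.
by move=> h; apply: big_ind => //; [exact: in_span0 | exact: in_spanD].
Qed.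

Lemma mem_in_span s w : w \in s -> in_span s w.
Proof.
rewrite -index_mem => ws; exists (fun i => (i == Ordinal ws)%:R).
rewrite (bigD1 (Ordinal ws)) //= eqxx scale1r nth_index -?index_mem //.
by rewrite big1 ?addr0 // => i /negPf ->; rewrite scale0r.
Qed.

Lemma in_span_trans s s' v :
  (forall w, w \in s -> in_span s' w) -> in_span s v -> in_span s' v.
Proof.
move=> ss' [c ->]; apply: in_span_sum => i _; apply: in_spanZ; apply: ss'.
exact: mem_nth.
Qed.

Lemma in_span_dependent s (T : finType) (x : T -> V) :
  (size s < #|T|)%N -> (forall t, in_span s (x t)) ->
  exists2 c : T -> K, exists t, c t != 0 & \sum_t c t *: x t = 0.
Proof.
move=> sT /choice [C CE].
pose M := \matrix_(i < #|T|, l < size s) C (enum_val i) l.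
have /matrix0Pn [i0 [l0 kr0]] : kermx M != 0.
  rewrite -mxrank_eq0 mxrank_ker -lt0n subn_gt0.
  by rewrite (leq_ltn_trans _ sT) // rank_leq_col.
exists (fun t => kermx M i0 (enum_rank t)).
  by exists (enum_val l0); rewrite enum_valK.
under eq_bigr do rewrite CE scaler_sumr.
rewrite exchange_big big1 //= => l _.
have := congr1 (fun A : 'M__ => A i0 l) (mulmx_ker M).
rewrite !mxE (reindex _ (onW_bij _ (@enum_val_bij T))) /= => e.
rewrite -[RHS](scale0r s`_l) -[in RHS]e scaler_suml; apply: eq_bigr => i _.
by rewrite enum_valK !mxE scalerA.
Qed.

End Span.

Section DifferentialRank.
Variables (K : fieldType) (V : lmodType K) (d : K -> K) (D : V -> V).
Hypothesis DD : {morph D : u v / u + v}.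
Hypothesis DZ : forall c v, D (c *: v) = d c *: v + c *: D v.

(** Linear independence over the ring of linear differential operators. *)
Definition op_indep (I : finType) (S : {set I}) (w : I -> V) :=
  forall N (c : I -> nat -> K),
    \sum_(j in S) \sum_(k < N) c j k *: iter k D (w j) = 0 ->
    forall j k, j \in S -> (k < N)%N -> c j k = 0.

Definition jets (I : finType) (w : I -> V) (S : {set I}) N :=
  [seq iter k D (w j) | j <- enum S, k <- iota 0 N].

Lemma mem_jets (I : finType) (w : I -> V) (S : {set I}) N j k :
  j \in S -> (k < N)%N -> iter k D (w j) \in jets w S N.
Proof.
by move=> jS kN; apply: allpairs_f; rewrite ?mem_enum ?mem_iota.
Qed.

Lemma mem_jets_catl (I : finType) (w : I -> V) (S : {set I}) N s j k :
  j \in S -> (k < N)%N -> iter k D (w j) \in jets w S N ++ s.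
Proof. by move=> jS kN; rewrite mem_cat mem_jets. Qed.

Lemma mem_jets_catr (I : finType) (w : I -> V) (S : {set I}) N s j k :
  j \in S -> (k < N)%N -> iter k D (w j) \in s ++ jets w S N.
Proof. by move=> jS kN; rewrite mem_cat mem_jets ?orbT. Qed.

Lemma jetsP (I : finType) (w : I -> V) (S : {set I}) N v :
  v \in jets w S N ->
  exists j k, [/\ j \in S, (k < N)%N & v = iter k D (w j)].
Proof.
case/allpairsP => -[j k] /= []; rewrite mem_enum mem_iota => jS kN ->.
by exists j, k.
Qed.

Lemma size_jets (I : finType) (w : I -> V) (S : {set I}) N :
  size (jets w S N) = (#|S| * N)%N.
Proof. by rewrite size_allpairs size_iota -cardE. Qed.

Lemma semilinear0 : D 0 = 0.
Proof. by apply: (addrI (D 0)); rewrite -DD !addr0. Qed.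

Lemma semilinear_in_span (s s' : seq V) v :
  (forall w, w \in s -> in_span s' w /\ in_span s' (D w)) ->
  in_span s v -> in_span s' (D v).
Proof.
move=> ss' [c ->]; rewrite (big_morph D DD semilinear0).
apply: in_span_sum => i _; rewrite DZ.
have [h1 h2] := ss' _ (mem_nth 0 (ltn_ord i)).
by apply: in_spanD; apply: in_spanZ.
Qed.

Lemma iter_in_span_jets (I : finType) (w : I -> V) N v l :
  in_span (jets w setT N) v -> in_span (jets w setT (N + l)) (iter l D v).
Proof.
move=> vN; elim: l => [|l IH]; first by rewrite addn0.
apply: semilinear_in_span IH => u /jetsP [j [k [_ kN ->]]].
by split; apply: mem_in_span; rewrite -?iterS mem_jets ?inE //; lia.
Qed.

(** In a relation involving [w j], its derivative of highest order can be
    isolated, because the coefficients form a field. *)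
Lemma op_dependent_order (I : finType) (w : I -> V) (S : {set I}) j :
  op_indep S w -> j \notin S -> ~ op_indep (j |: S) w ->
  exists N e, in_span (jets w S N ++ jets w [set j] e) (iter e D (w j)).
Proof.
move=> Si jS /existsNP [N] /existsNP [c] /not_implyP [].
rewrite big_setU1 //= => rel ndep.
have [k0 ck0] : exists k : 'I_N, c j k != 0.
  apply: contra_notP ndep => /forallNP ndep.
  have cj k : (k < N)%N -> c j k = 0.
    by move=> kN; have /negP := ndep (Ordinal kN); rewrite negbK => /eqP.
  move=> i k; rewrite in_setU1 => /orP [/eqP -> //|iS]; first exact: cj.
  apply: Si iS; rewrite -[RHS]rel [X in _ = X + _]big1 ?add0r // => l _.
  by rewrite cj ?scale0r.
case: (@arg_maxnP _ k0 (fun k : 'I_N => c j k != 0) val) => // e ce emax.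
exists N, e; set s := _ ++ _.
have -> : iter e D (w j) = (c j e)^-1 *: (c j e *: iter e D (w j)).
  by rewrite scalerA mulVf ?scale1r.
apply: in_spanZ.
have -> : c j e *: iter e D (w j) = (-1) *: (\sum_(k < N | k != e)
    c j k *: iter k D (w j) + \sum_(i in S) \sum_(k < N) c i k *: iter k D (w i)).
  move: rel; rewrite (bigD1 e) //= -addrA => /eqP; rewrite addr_eq0 => /eqP ->.
  by rewrite scaleN1r.
apply: in_spanZ; apply: in_spanD; apply: in_span_sum => i iP.
  have [->|ci] := eqVneq (c j i) 0; first by rewrite scale0r; exact: in_span0.
  apply: in_spanZ; apply: mem_in_span; apply: mem_jets_catr; rewrite ?set11 //.
  by rewrite ltn_neqAle iP; exact: emax.
apply: in_span_sum => k _; apply: in_spanZ; apply: mem_in_span.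
exact: mem_jets_catl.
Qed.

Lemma op_dependent_in_span (I : finType) (w : I -> V) (S : {set I}) j N e l :
  in_span (jets w S N ++ jets w [set j] e) (iter e D (w j)) ->
  in_span (jets w S (N + l) ++ jets w [set j] e) (iter (e + l) D (w j)).
Proof.
move=> we; elim: l => [|l IH]; first by rewrite !addn0.
rewrite !addnS iterS; apply: semilinear_in_span IH => u; rewrite mem_cat.
case/orP => /jetsP [i [k [iS kN ->]]].
  by split; apply: mem_in_span; rewrite -?iterS mem_jets_catl //; lia.
move: iS; rewrite inE => /eqP ->; split.
  by apply: mem_in_span; rewrite mem_jets_catr ?set11.
have [ke|ke] := ltnP k.+1 e.
  by apply: mem_in_span; rewrite -iterS mem_jets_catr ?set11.
rewrite -iterS (_ : k.+1 = e); last lia.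
apply: in_span_trans we => v; rewrite !mem_cat => /orP [] vS.
  have [i' [k' [iS' kN' ->]]] := jetsP vS.
  by apply: mem_in_span; rewrite mem_jets_catl //; lia.
by apply: mem_in_span; rewrite mem_cat vS orbT.
Qed.

(** The jets of order below [N] of a family with [m] independent members among
    its generators span a space of dimension [m N + O(1)]; [n] independent
    elements of the module it generates need [n N - O(1)] dimensions. *)
Lemma op_rank_le (I : finType) (w : I -> V) n (b : 'I_n -> V) h :
  op_indep setT b -> (forall i, in_span (jets w setT h) (b i)) ->
  exists2 S : {set I}, op_indep S w & (n <= #|S|)%N.
Proof.
move=> bi bs; have i0 : op_indep set0 w by move=> N c _ j k; rewrite inE.
case: (@arg_maxnP _ set0 (fun S => `[< op_indep S w >]) (fun S => #|S|)).
  exact/asboolP.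
move=> S /asboolP Si Smax; exists S => //.
have /choice [o oP] j : exists o, j \notin S ->
    in_span (jets w S o.1 ++ jets w [set j] o.2) (iter o.2 D (w j)).
  have [jS|jS] := boolP (j \in S); first by exists (0, 0)%N.
  have [|N [e he]] := op_dependent_order Si jS; last by exists (N, e).
  move=> /asboolP /Smax; rewrite cardsU1 jS add1n /=.
  by rewrite ltnn.
pose h1 := \max_j (o j).1; pose e := \max_j (o j).2.
have h1_ge j : ((o j).1 <= h1)%N by exact: leq_bigmax.
have e_ge j : ((o j).2 <= e)%N by exact: leq_bigmax.
pose s M := jets w S (h1 + M) ++ jets w (~: S) e.
have ws M j k : (k < M)%N -> in_span (s M) (iter k D (w j)).
  move=> kM; have [jS|jS] := boolP (j \in S).
    by apply: mem_in_span; rewrite mem_jets_catl //; lia.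
  have [ke|ke] := ltnP k (o j).2.
    apply: mem_in_span; rewrite mem_jets_catr ?inE //.
    exact: leq_trans (e_ge j).
  have := op_dependent_in_span (k - (o j).2) (oP j jS); rewrite subnKC //.
  apply: in_span_trans => v; rewrite mem_cat => /orP [] /jetsP [i [l [iS lN ->]]].
    by apply: mem_in_span; rewrite mem_jets_catl //; have := h1_ge j; lia.
  move: iS; rewrite inE => /eqP ->; apply: mem_in_span.
  by rewrite mem_jets_catr ?inE // (leq_trans lN).
(* The jets of [b] of order below [N] lie in the span of [s (h + N)]. *)
have bound N : (n * N <= #|S| * (h1 + (h + N)) + #|~: S| * e)%N.
  rewrite leqNgt; apply/negP => lt.
  have [| |c [[i k] cik] rel] := @in_span_dependent _ V (s (h + N)%N)
    ('I_n * 'I_N)%type (fun ik => iter ik.2 D (b ik.1)).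
  - by rewrite card_prod !card_ord size_cat !size_jets.
  - move=> [i k] /=; apply: (in_span_trans _ (iter_in_span_jets k (bs i))).
    by move=> v /jetsP [j [l [_ lN ->]]]; apply: ws; have := ltn_ord k; lia.
  pose c' i (k : nat) := if insub k is Some k' then c (i, k') else 0.
  have c'E j (l : 'I_N) : c' j l = c (j, l) by rewrite /c' valK.
  suff e0 : c' i k = 0 by rewrite -c'E e0 eqxx in cik.
  apply: (bi N c'); rewrite ?inE // -[RHS]rel.
  transitivity (\sum_i \sum_k c (i, k) *: iter k D (b i)); last first.
    by rewrite pair_bigA; apply: eq_bigr => -[].
  apply: eq_big => [j|j _]; rewrite ?inE //.
  by apply: eq_bigr => l _; rewrite c'E.
rewrite leqNgt; apply/negP => lt.
have := bound (#|S| * (h1 + h) + #|~: S| * e).+1.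
set N := _.+1 => bN.
suff : (#|S|.+1 * N <= n * N)%N by rewrite /N in bN *; nia.
by rewrite leq_mul2r lt orbT.
Qed.

End DifferentialRank.

(** * Leading coefficients *)

(** Abstracts the rules of computation with leading coefficients: [L e x y]
    stands for [x] being of degree at most [e], with coefficient [y] there. *)
Record graded_rel (X Y : comNzRingType) (L : int -> X -> Y -> Prop) : Prop :=
  GradedRel {
    graded0 : forall e, L e 0 0;
    graded1 : L 0 1 1;
    gradedN1 : L 0 (-1) (-1);
    gradedD : forall e x y x' y', L e x y -> L e x' y' -> L e (x + x') (y + y');
    gradedM : forall e e' x y x' y',
      L e x y -> L e' x' y' -> L (e + e') (x * x') (y * y')
  }.

Section GradedRel.
Variables (X Y : comNzRingType) (L : int -> X -> Y -> Prop).
Hypothesis gL : graded_rel L.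

Lemma graded_sum (I : Type) (r : seq I) (P : pred I) e (x : I -> X) (y : I -> Y) :
  (forall i, P i -> L e (x i) (y i)) ->
  L e (\sum_(i <- r | P i) x i) (\sum_(i <- r | P i) y i).
Proof.
move=> h; apply: (big_ind2 (L e)) => //; first exact: graded0.
by move=> *; apply: gradedD.
Qed.

Lemma graded_prod (I : Type) (r : seq I) (P : pred I) (e : I -> int)
    (x : I -> X) (y : I -> Y) :
  (forall i, P i -> L (e i) (x i) (y i)) -> L (\sum_(i <- r | P i) e i)
    (\prod_(i <- r | P i) x i) (\prod_(i <- r | P i) y i).
Proof.
move=> h; elim: r => [|i r IH]; first by rewrite !big_nil; exact: graded1.
by rewrite !big_cons; case: ifP => // Pi; apply: gradedM => //; exact: h.
Qed.

Lemma graded_sign k : L 0 ((-1) ^+ k) ((-1) ^+ k).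
Proof.
elim: k => [|k IH]; first exact: graded1.
by rewrite !exprS; have := gradedM gL (gradedN1 gL) IH; rewrite addr0.
Qed.

Lemma graded_det n (e : 'I_n -> int) (M : 'M[X]_n) (M0 : 'M[Y]_n) :
  (forall i j, L (e i) (M i j) (M0 i j)) ->
  L (\sum_i e i) (\det M) (\det M0).
Proof.
move=> h; apply: graded_sum => s _; rewrite -[\sum_i e i]add0r.
by apply: (gradedM gL); [exact: graded_sign | apply: graded_prod => i _].
Qed.

Lemma graded_cofactor n (e : 'I_n -> int) (M : 'M[X]_n) (M0 : 'M[Y]_n) i j :
  (forall i j, L (e i) (M i j) (M0 i j)) ->
  L (\sum_i e i - e i) (cofactor M i j) (cofactor M0 i j).
Proof.
move=> h; rewrite /cofactor -[\sum_i e i - e i]add0r; apply: (gradedM gL).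
  exact: graded_sign.
case: n e M M0 i j h => [|n] e M M0 i j h; first by case: i.
rewrite (bigD1_ord i) //= addrAC subrr add0r.
by apply: graded_det => k l; rewrite !mxE.
Qed.

End GradedRel.

(** A rule [L] blind to degrees: evaluations of the same formal polynomials. *)
Definition teval_rel (F U : Type) (X Y : nzRingType) (i : F -> X) (j : F -> Y)
    (a : U -> X) (b : U -> Y) (x : X) (y : Y) :=
  exists2 t, x = teval i a t & y = teval j b t.

Lemma graded_teval_rel (F : fieldType) (U : Type) (X Y : comNzRingType)
    (i : {rmorphism F -> X}) (j : {rmorphism F -> Y}) (a : U -> X) (b : U -> Y) :
  graded_rel (fun _ : int => teval_rel i j a b).
Proof.
split=> [_|||_ x y x' y' [t -> ->] [t' -> ->]|_ _ x y x' y' [t -> ->] [t' -> ->]].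
- by exists (TConst 0); rewrite /= rmorph0.
- by exists (TConst 1); rewrite /= rmorph1.
- by exists (TConst (-1)); rewrite /= rmorphN1.
- by exists (TAdd t t').
- by exists (TMul t t').
Qed.

(** The degree bound is an integer, so that it can be shifted freely; only the
    zero polynomial has a negative one. *)
Definition top_coef (S : nzRingType) (e : int) (p : {poly S}) (c : S) :=
  (forall i : nat, e < i%:Z -> p`_i = 0) /\
  (if e is Posz k then p`_k = c else c = 0).

Lemma top_coef_neg (S : nzRingType) k (p : {poly S}) c :
  top_coef (Negz k) p c -> p = 0 /\ c = 0.
Proof. by move=> [pe ->]; split=> //; apply/polyP => i; rewrite coef0 pe. Qed.

Lemma top_coef0 (S : nzRingType) e (c : S) : top_coef e 0 c -> c = 0.
Proof. by case: e => k [_]; rewrite ?coef0. Qed.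

Lemma top_coef_size (S : nzRingType) (k : nat) (p : {poly S}) :
  (size p <= k.+1)%N -> top_coef k p p`_k.
Proof.
by move=> pk; split=> // i ki; apply/(leq_sizeP _ _ pk).
Qed.

Lemma top_coef_lt (S : nzRingType) e e' (p : {poly S}) c :
  e < e' -> top_coef e p c -> top_coef e' p 0.
Proof.
move=> ee' [pe pc]; split=> [i ei|]; first by apply: pe; exact: lt_trans ei.
by case: e' ee' => // k ek; apply: pe.
Qed.

Lemma graded_top_coef (S : comNzRingType) : graded_rel (@top_coef S).
Proof.
split=> [e|||e p c p' c' [pe pc] [pe' pc']|e e' p c p' c' hp hp'].
- by split=> [i _|]; [|case: e => k]; rewrite ?coef0.
- by split=> [[|i] // _|] /=; rewrite coef1.
- by split=> [[|i] // _|] /=; rewrite coefN coef1 ?oppr0.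
- split=> [i ei|]; first by rewrite coefD pe // pe' // addr0.
  by case: e pc pc' {pe pe'} => k; [rewrite coefD|] => -> ->; rewrite ?addr0.
have z0 e1 : top_coef e1 (0 : {poly S}) 0.
  by split=> [i _|]; [|case: e1 => k]; rewrite ?coef0.
case: e hp => k hp; last first.
  by have [-> ->] := top_coef_neg hp; rewrite !mul0r.
case: e' hp' => k' hp'; last first.
  by have [-> ->] := top_coef_neg hp'; rewrite !mulr0.
move: hp hp' => [pe pc] [pe' pc'].
have sz i : (k + k' <= i)%N -> (p * p')`_i = c * c' *+ (i == k + k')%N.
  move=> ki; have ki' : (k < i.+1)%N by lia.
  rewrite coefM (bigD1 (Ordinal ki')) //= big1 => [|j jk]; last first.
    have [jk1|jk1] := ltnP k j; first by rewrite pe ?mul0r.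
    rewrite pe' ?mulr0 //; suff: (j < k)%N by lia.
    by rewrite ltn_neqAle jk1 andbT.
  rewrite addr0 pc; have [->|ik] := eqVneq i (k + k')%N.
    by rewrite addKn pc' mulr1n.
  by rewrite pe' ?mulr0 //; lia.
rewrite -PoszD; split=> [i ei|]; last by rewrite sz // eqxx.
by rewrite sz; [rewrite (_ : (_ == _) = false) //|]; lia.
Qed.

Lemma top_coef_mulXn (S : nzRingType) e r (p : {poly S}) c :
  top_coef e (p * 'X^r) c -> top_coef (e - r%:Z) p c.
Proof.
have coefXr i : p`_i = (p * 'X^r)`_(i + r).
  by rewrite coefMXn ltnNge leq_addl addnK.
move=> [pe pc]; split=> [i ei|]; first by rewrite coefXr pe //; lia.
case: e pe pc => [k|k] pe pc; last by rewrite (_ : Negz k - r%:Z = Negz (k + r)) //; lia.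
have [rk|rk] := leqP r k.
  by rewrite (_ : k%:Z - r%:Z = (k - r)%N) ?coefXr ?subnK //; lia.
rewrite (_ : k%:Z - r%:Z = Negz (r - k).-1); last lia.
by rewrite -pc coefMXn rk.
Qed.

Lemma top_coef_map (S : nzRingType) (d : S -> S) (hd : derivation d) e
    (p : {poly S}) c :
  top_coef e p c -> top_coef e (map_poly d p) (d c).
Proof.
move=> [pe pc]; split=> [i ei|]; first by rewrite coef_map_id0 ?pe ?der0.
by case: e pc {pe} => k; rewrite ?coef_map_id0 ?der0 // => -> //; exact: der0.
Qed.

Lemma map_poly_derivation (S : nzRingType) (d : S -> S) (hd : derivation d) :
  derivation (map_poly d).
Proof.
split=> p q; apply/polyP => i.
  by rewrite coefD !coef_map_id0 ?der0 // coefD hd.1.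
rewrite coefD coef_map_id0 ?der0 // !coefM (der_sum hd) -big_split /=.
by apply: eq_bigr => j _; rewrite hd.2 !coef_map_id0 ?der0.
Qed.

Section LeadingForm.
Variables (F K : fieldType) (iota : {rmorphism F -> K}).
Variables (U : eqType) (a : U -> K).
Hypothesis ai : alg_indep iota a.
Hypothesis ag : generated_by iota a.

(** The polynomial collecting the homogeneous components of an element. *)
Definition homog_rel (x : K) (p : {poly K}) :=
  teval_rel iota (polyC \o iota : {rmorphism F -> {poly K}}) a
    (fun u => a u *: 'X) x p.

Let gH : graded_rel (fun=> homog_rel). Proof. exact: graded_teval_rel. Qed.

Let hD x p y q : homog_rel x p -> homog_rel y q -> homog_rel (x + y) (p + q).
Proof. exact: (gradedD gH (e := 0)). Qed.

Let hM x p y q : homog_rel x p -> homog_rel y q -> homog_rel (x * y) (p * q).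
Proof. exact: (gradedM gH (e := 0) (e' := 0)). Qed.

Let hr1 : homog_rel 1 1. Proof. exact: (graded1 gH). Qed.

Lemma homog_rel_eq0 x p : homog_rel x p -> (x == 0) = (p == 0).
Proof.
move=> [t -> ->]; apply/eqP/eqP => [|e]; first exact: alg_indep_teval.
have <- : (teval (polyC \o iota) (fun u => a u *: 'X) t).[1] = teval iota a t.
  elim: t {e} => [c|u|t1 e1 t2 e2|t1 e1 t2 e2] /=.
  - by rewrite hornerC.
  - by rewrite hornerZ hornerX mulr1.
  - by rewrite hornerD e1 e2.
  - by rewrite hornerM e1 e2.
by rewrite e horner0.
Qed.

(** [x] is a quotient of polynomials in the generators, of degree at most [e]
    for the total degree, and [c] is the quotient of their leading forms, or
    zero if the degree is smaller than [e]. *)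
Definition leading_form (e : int) (x c : K) :=
  exists f g p q N b, [/\ homog_rel f p, homog_rel g q & x * g = f] /\
    [/\ top_coef N q b, b != 0 & top_coef (N + e) p (c * b)].

Lemma graded_leading_form : graded_rel leading_form.
Proof.
have gT := graded_top_coef K.
have k1 x : homog_rel x x%:P -> leading_form 0 x x.
  move=> xx; exists x, 1, x%:P, 1, 0, 1; rewrite oner_neq0 !mulr1 add0r.
  split; first by split=> //; exact: hr1.
  split=> //; first exact: (graded1 gT).
  by split=> [[|i] // _|] /=; rewrite coefC.
split.
- move=> e; exists 0, 1, 0, 1, 0, 1; rewrite oner_neq0 !mul0r.
  split; split=> //; [exact: (graded0 gH 0)| |].
    exact: (graded1 gT).
  exact: (graded0 gT).
- by apply: k1; exact: hr1.
- by apply: k1; rewrite polyCN; exact: (gradedN1 gH).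
- move=> e x c x' c' [f [g [p [q [N [b [[hf hg xE] [qN b0 pN]]]]]]]].
  move=> [f' [g' [p' [q' [N' [b' [[hf' hg' xE'] [qN' b0' pN']]]]]]]].
  exists (f * g' + f' * g), (g * g'), (p * q' + p' * q), (q * q'), (N + N').
  exists (b * b'); split; split.
  + by apply: hD; apply: hM.
  + exact: hM.
  + by rewrite -xE -xE'; ring.
  + exact: (gradedM gT).
  + exact: mulf_neq0.
  + rewrite (_ : (c + c') * (b * b') = c * b * b' + c' * b' * b); last by ring.
    apply: (gradedD gT).
      by rewrite (_ : N + N' + e = N + e + N'); [apply: (gradedM gT) | ring].
    by rewrite (_ : N + N' + e = N' + e + N); [apply: (gradedM gT) | ring].
- move=> e e' x c x' c' [f [g [p [q [N [b [[hf hg xE] [qN b0 pN]]]]]]]].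
  move=> [f' [g' [p' [q' [N' [b' [[hf' hg' xE'] [qN' b0' pN']]]]]]]].
  exists (f * f'), (g * g'), (p * p'), (q * q'), (N + N'), (b * b').
  split; split.
  + exact: hM.
  + exact: hM.
  + by rewrite -xE -xE'; ring.
  + exact: (gradedM gT).
  + exact: mulf_neq0.
  + rewrite (_ : N + N' + (e + e') = (N + e) + (N' + e')); last by ring.
    by rewrite (_ : c * c' * (b * b') = c * b * (c' * b'));
      [apply: (gradedM gT) | ring].
Qed.

Lemma leading_form_eq0 e x c : leading_form e x c -> x = 0 -> c = 0.
Proof.
move=> [f [g [p [q [N [b [[hf _ xE] [_ b0 pN]]]]]]]] x0.
move: hf; rewrite -xE x0 mul0r => /homog_rel_eq0; rewrite eqxx => /esym /eqP p0.
move: pN; rewrite p0 => /top_coef0 /eqP; rewrite mulf_eq0 (negPf b0) orbF.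
by move/eqP.
Qed.

Lemma leading_form_lt e e' x c :
  e < e' -> leading_form e x c -> leading_form e' x 0.
Proof.
move=> ee' [f [g [p [q [N [b [h [qN b0 pN]]]]]]]].
exists f, g, p, q, N, b; split=> //; split=> //; rewrite mul0r.
by apply: top_coef_lt pN; rewrite ltrD2l.
Qed.

Lemma leading_formV e x c :
  c != 0 -> leading_form e x c -> leading_form (- e) x^-1 c^-1.
Proof.
move=> c0 h; have x0 : x != 0.
  by apply: contra_neq c0; exact: leading_form_eq0 h.
move: h => [f [g [p [q [N [b [[hf hg xE] [qN b0 pN]]]]]]]].
exists g, f, q, p, (N + e), (c * b); rewrite addrK mulKf //.
by split; split=> //; [rewrite -xE mulKf | rewrite mulf_neq0].
Qed.

Lemma exists_leading_form x : x != 0 ->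
  exists e c, c != 0 /\ leading_form e x c.
Proof.
have [t [t' [t0 ->]]] := generated_by_frac ag x.
set f := teval _ _ t; set g := teval _ _ t' => fg0.
pose p := teval (polyC \o iota) (fun u => a u *: 'X) t.
pose q := teval (polyC \o iota) (fun u => a u *: 'X) t'.
have hf : homog_rel f p by exists t.
have hg : homog_rel g q by exists t'.
have q0 : q != 0 by rewrite -(homog_rel_eq0 hg).
have p0 : p != 0.
  by rewrite -(homog_rel_eq0 hf); apply: contra_neq fg0 => ->; rewrite mul0r.
exists ((size p).-1%:Z - (size q).-1%:Z), (lead_coef p / lead_coef q).
split; first by rewrite mulf_neq0 ?invr_eq0 ?lead_coef_eq0.
exists f, g, p, q, (size q).-1%:Z, (lead_coef q).
split; first by rewrite divfK.
rewrite lead_coef_eq0 divfK ?lead_coef_eq0 // addrC subrK.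
by split=> //; apply: top_coef_size; rewrite leqSpred.
Qed.

(** Normalising the weighted degrees of a finite family by their maximum. *)
Lemma exists_leading_forms (I : finType) (w : I -> int) (x : I -> K) i0 :
  x i0 != 0 -> exists e c, (forall i, leading_form (e - w i) (x i) (c i)) /\
    exists i, c i != 0.
Proof.
move=> x0; have gL := graded_leading_form.
have /choice [f fP] i : exists ec, x i != 0 ->
    ec.2 != 0 /\ leading_form ec.1 (x i) ec.2.
  have [->|xi] := eqVneq (x i) 0; first by exists (0, 0).
  by have [e [c [c0 ec]]] := exists_leading_form xi; exists (e, c).
case: (@Order.TotalTheory.arg_maxP _ _ _ i0 (fun i => x i != 0)
  (fun i => (f i).1 + w i)) => // i1 x1 max1.
pose e := (f i1).1 + w i1.
exists e, (fun i => if (x i != 0) && ((f i).1 + w i == e) then (f i).2 else 0).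
split=> [i|]; last by exists i1; rewrite x1 eqxx; case: (fP _ x1).
have [->|xi] := eqVneq (x i) 0; first by exact: (graded0 gL).
have [_ h] := fP _ xi; case: eqVneq => [<-|ne] /=; first by rewrite addrK.
by apply: leading_form_lt h; rewrite ltrBrDr lt_neqAle ne; exact: max1.
Qed.

(** A derivation acting on each homogeneous component and lowering its degree
    by [r]; the factor ['X^r] expresses the shift without subtraction. *)
Definition degree_derivation (r : nat) (d : K -> K) :=
  derivation d /\ forall x p, homog_rel x p ->
    exists2 p', homog_rel (d x) p' & p' * 'X^r = map_poly d p.

Lemma degree_derivation_gen r d : derivation d ->
  (forall c, exists2 p, homog_rel (d (iota c)) p &
     p * 'X^r = (d (iota c))%:P) ->
  (forall u, exists2 p, homog_rel (d (a u)) p & p * 'X^r = d (a u) *: 'X) ->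
  degree_derivation r d.
Proof.
move=> hd hc ha; split=> // _ _ [t -> ->].
have hd' := map_poly_derivation hd.
have hr s : homog_rel (teval iota a s)
    (teval (polyC \o iota) (fun u => a u *: 'X) s) by exists s.
elim: t => [c|u|t1 [p1 h1 e1] t2 [p2 h2 e2]|t1 [p1 h1 e1] t2 [p2 h2 e2]] /=.
- have [p h e] := hc c; exists p => //; rewrite e.
  by apply/polyP => i; rewrite coef_map_id0 ?der0 // !coefC; case: ifP; rewrite ?der0.
- have [p h e] := ha u; exists p => //; rewrite e.
  apply/polyP => i; rewrite coef_map_id0 ?der0 // !coefZ coefX.
  by rewrite hd.2 (der_bool hd) mulr0 addr0.
- exists (p1 + p2); first by rewrite hd.1; exact: hD.
  by rewrite mulrDl e1 e2 hd'.1.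
- pose q s := teval (polyC \o iota) (fun u => a u *: 'X) s : {poly K}.
  exists (p1 * q t2 + q t1 * p2).
    by rewrite hd.2; apply: hD; apply: hM.
  by rewrite hd'.2 -e1 -e2 /q; ring.
Qed.

Lemma leading_form_der r d e x c : degree_derivation r d ->
  leading_form e x c -> leading_form (e - r%:Z) (d x) (d c).
Proof.
move=> [hd hH] [f [g [p [q [N [b [[hf hg xE] [qN b0 pN]]]]]]]].
have gT := graded_top_coef K.
have [p' hp' pE] := hH _ _ hf; have [q' hq' qE] := hH _ _ hg.
have hN1 s h : homog_rel s h -> homog_rel (- s) (- h).
  by move=> sh; rewrite -mulN1r -[- h]mulN1r; apply: hM sh;
    exact: (gradedN1 gH).
exists (d f * g - f * d g), (g * g), (p' * q - p * q'), (q * q), (N + N), (b * b).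
split; split.
- by apply: hD; [|apply: hN1]; apply: hM.
- exact: hM.
- by rewrite -xE hd.2; ring.
- exact: (gradedM gT).
- exact: mulf_neq0.
rewrite addrA; apply: top_coef_mulXn.
rewrite (_ : _ * 'X^r = map_poly d p * q + (-1) * (p * map_poly d q)); last first.
  by rewrite -pE -qE; ring.
rewrite (_ : d c * (b * b) = d (c * b) * b + (-1) * (c * b * d b)); last first.
  by rewrite hd.2; ring.
rewrite (_ : N + N + e = N + e + N); last by ring.
apply: (gradedD gT); first by apply: (gradedM gT) => //; exact: top_coef_map.
rewrite -[N + e + N]add0r; apply: (gradedM gT); first exact: (gradedN1 gT).
by apply: (gradedM gT) => //; exact: top_coef_map.
Qed.

Lemma leading_form_gen u : leading_form 1 (a u) (a u).
Proof.
exists (a u), 1, (a u *: 'X), 1, 0, 1; rewrite oner_neq0 !mulr1 add0r.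
have gT := graded_top_coef K.
split; first by split=> //; exists (TVar u).
split=> //; first exact: (graded1 gT).
split=> [[|[|i]] // _|] /=; rewrite coefZ coefX ?mulr0 ?mulr1 //.
Qed.

(** Cofactor expansion: the degree of each row of [M] becomes the opposite degree
    of the corresponding column of the inverse. *)
Lemma leading_form_invmx n (e : 'I_n -> int) (M M0 : 'M[K]_n) i j :
  (forall i j, leading_form (e i) (M i j) (M0 i j)) -> M0 \in unitmx ->
  M \in unitmx /\ leading_form (- e j) (invmx M i j) (invmx M0 i j).
Proof.
move=> h M0u; have gL := graded_leading_form.
have d0 : \det M0 != 0 by rewrite -unitfE.
have hd := graded_det gL h.
have Mu : M \in unitmx.
  rewrite unitmxE unitfE; apply: contra_neq d0; exact: leading_form_eq0 hd.
split=> //; rewrite /invmx Mu M0u !mxE.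
have -> : - e j = - \sum_i e i + (\sum_i e i - e j) by ring.
apply: (gradedM gL); first exact: leading_formV.
exact: (graded_cofactor gL).
Qed.

End LeadingForm.

(** * Cyclic vectors *)

(** Coordinates of the derivative of [v *m Y] when [Y] solves the equation with
    matrix [A]. *)
Definition nabla (R : nzRingType) (d : R -> R) n (A : 'M[R]_n) (v : 'rV[R]_n) :=
  map_mx d v + v *m A.

Definition krylov (R : nzRingType) (d : R -> R) n (A : 'M[R]_n) (v : 'rV[R]_n) :=
  \matrix_(k < n) iter k (nabla d A) v.

(** The last row of the companion matrix of the equation in the basis
    [krylov d A v]. *)
Definition companion_row (K : fieldType) (d : K -> K) n (A : 'M[K]_n)
    (v : 'rV[K]_n) :=
  iter n (nabla d A) v *m invmx (krylov d A v).

Lemma graded_iter_nabla (X Y : comNzRingType) (L : int -> X -> Y -> Prop)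
    (gL : graded_rel L) (d : X -> X) n (A : 'M[X]_n) (A0 : 'M[Y]_n)
    (v : 'rV_n) (v0 : 'rV_n) e k j :
  (forall e x y, L e x y -> L (e + 1) (d x) 0) ->
  (forall i j, L 1 (A i j) (A0 i j)) -> (forall j, L e (v 0 j) (v0 0 j)) ->
  L (e + k%:Z) (iter k (nabla d A) v 0 j) (iter k (nabla (fun=> 0) A0) v0 0 j).
Proof.
move=> hd hA hv; elim: k j => [|k IH] j /=; first by rewrite addr0.
rewrite !mxE (_ : e + k.+1%:Z = e + k%:Z + 1); last lia.
apply: (gradedD gL); first by apply: hd (IH j).
by apply: (graded_sum gL) => i _; apply: (gradedM gL).
Qed.

Lemma iter_nabla0 (R : nzRingType) n (A : 'M[R]_n.+1) (v : 'rV[R]_n.+1) k :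
  iter k (nabla (fun=> 0) A) v = v *m A ^+ k.
Proof.
elim: k => [|k IH]; first by rewrite mulmx1.
rewrite iterS IH exprSr -mulmxE mulmxA /nabla.
rewrite (_ : map_mx _ _ = 0) ?add0r //.
by apply/matrixP => i j; rewrite !mxE.
Qed.

Lemma iter_nabla_companion (K : fieldType) (d : K -> K) n (A : 'M[K]_n) v :
  krylov d A v \in unitmx ->
  iter n (nabla d A) v = companion_row d A v *m krylov d A v.
Proof. by move=> u; rewrite mulmxKV. Qed.

(** Without derivation, the companion row does not depend on the cyclic vector:
    by Cayley-Hamilton it is read off the characteristic polynomial. *)
Lemma companion_row0 (K : fieldType) n (A : 'M[K]_n.+1) v w :
  krylov (fun=> 0) A v \in unitmx -> krylov (fun=> 0) A w \in unitmx ->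
  companion_row (fun=> 0) A v = companion_row (fun=> 0) A w.
Proof.
suff h u : krylov (fun=> 0) A u \in unitmx ->
    companion_row (fun=> 0) A u = \row_k - (char_poly A)`_k.
  by move=> hv hw; rewrite !h.
move=> hu; rewrite /companion_row.
rewrite (_ : iter _ _ _ = (\row_k - (char_poly A)`_k) *m krylov (fun=> 0) A u).
  by rewrite mulmxK.
have := Cayley_Hamilton A.
rewrite /horner_mx /horner_morph horner_coef size_map_poly size_char_poly.
rewrite big_ord_recr /= coef_map /=.
have /monicP := char_poly_monic A; rewrite /lead_coef size_char_poly /= => ->.
rewrite [1%:M]/(1 : 'M_n.+1) mul1r addrC => /eqP; rewrite addr_eq0 => /eqP AE.
rewrite -[LHS]/(iter n.+1 _ _) (iter_nabla0 _ _ n.+1) AE mulmxN mulmx_sumr.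
rewrite mulmx_sum_row -sumrN.
apply: eq_bigr => k _; rewrite !mxE rowK iter_nabla0 coef_map /=.
by rewrite -mulmxE mul_scalar_mx -scalemxAr scaleNr.
Qed.

(** Gauge transformations transport cyclic vectors. *)
Lemma iter_nabla_gauge (K : fieldType) (d : K -> K) (hd : derivation d) n
    (A B P : 'M[K]_n) v k : P \in unitmx ->
  B = P *m A *m invmx P + map_mx d P *m invmx P ->
  iter k (nabla d B) v *m P = iter k (nabla d A) (v *m P).
Proof.
move=> Pu BE; elim: k => //= k <-; set u := iter k _ v.
rewrite /nabla (der_mulmx hd) mulmxDl -addrA; congr (_ + _).
by rewrite BE -mulmxDl -!mulmxA mulVmx // mulmx1 mulmxDr addrC.
Qed.

Section GenericMatrix.
Variables (F K : fieldType) (iota : {rmorphism F -> K}) (d : K -> K).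
Variables (n' : nat).
Let n := n'.+1.
Variable A : 'M[K]_n.

Definition jet (u : 'I_n * 'I_n * nat) : K := iter u.2 d (A u.1.1 u.1.2).

Hypothesis ai : alg_indep iota jet.
Hypothesis ag : generated_by iota jet.

(** The matrix of multiplication by [y] on [K[y]], as a free module over
    [K[y ^+ n]] with basis the powers of [y]; the variable is [y ^+ n]. *)
Let C : 'M[{poly K}]_n :=
  \matrix_(i, j) if i == ord_max then (j == 0)%:R * 'X else (j == i.+1 :> nat)%:R.

Let phi (v : 'rV[{poly K}]_n) : {poly K} := \sum_i (v 0 i \Po 'X^n) * 'X^i.

Let phi_eq0 v : phi v = 0 -> v = 0.
Proof.
move=> /polyP v0; apply/rowP => i; apply/polyP => l; rewrite mxE coef0.
have := v0 (l * n + i)%N; rewrite coef0 coef_sum (bigD1 i) //=.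
rewrite coefMXn ltnNge leq_addl addnK coef_comp_poly_Xn // dvdn_mull //.
rewrite mulnK // big1 ?addr0 // => j ji.
rewrite coefMXn; case: ltnP => // lij; rewrite coef_comp_poly_Xn //.
case: ifP => // /dvdnP [q qE]; case/negP: ji; apply/eqP/val_inj => /=.
have : (q * n + j = l * n + i)%N by rewrite -qE subnK.
by move=> /(congr1 (modn^~ n)); rewrite !modnMDl !modn_small.
Qed.

Let phi_mulC v : phi (v *m C) = 'X * phi v.
Proof.
rewrite /phi mulr_sumr.
under eq_bigr do rewrite mxE rmorph_sum /= mulr_suml.
rewrite exchange_big /=; apply: eq_bigr => i _.
under eq_bigr do rewrite rmorphM /= -mulrA.
rewrite -mulr_sumr mulrCA -exprS; congr (_ * _).
have [->|im] := eqVneq i ord_max.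
  rewrite (bigD1 0) //= big1 => [|j j0]; rewrite !mxE eqxx.
    by rewrite eqxx mul1r comp_polyX mulr1 addr0.
  by rewrite (negPf j0) mul0r rmorph0 mul0r.
have i1 : (i.+1 < n)%N.
  have := ltn_ord i; rewrite leq_eqVlt eqSS -[n']/(val (@ord_max n')) val_eqE.
  by rewrite (negPf im).
rewrite (bigD1 (Ordinal i1)) //= big1 => [|j ji]; rewrite !mxE (negPf im).
  by rewrite eqxx rmorph1 mul1r addr0.
by rewrite (negPf (_ : (j != i.+1 :> nat))) ?rmorph0 ?mul0r // -(inj_eq val_inj).
Qed.

(** [K[y]] has no zero divisors, so multiples of a nonzero vector by distinct
    elements of [K[y]] are distinct. *)
Lemma companion_cyclic (v : 'rV[{poly K}]_n) :
  v != 0 -> \det (krylov (fun=> 0) C v) != 0.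
Proof.
apply: contra => /det0P [m m0 mE].
have phiE : phi (m *m krylov (fun=> 0) C v) = phi m * phi v.
  rewrite mulmx_sum_row [X in X * _]/phi mulr_suml.
  have phi_iter k : phi (iter k (nabla (fun=> 0) C) v) = 'X^k * phi v.
    rewrite iter_nabla0; elim: k => [|k IH]; first by rewrite mulmx1 mul1r.
    by rewrite exprSr -mulmxE mulmxA phi_mulC IH exprS mulrA.
  have phiD : {morph phi : x y / x + y}.
    move=> x y; rewrite /phi -big_split; apply: eq_bigr => i _ /=.
    by rewrite mxE rmorphD mulrDl.
  have phiZ c x : phi (c *: x) = (c \Po 'X^n) * phi x.
    by rewrite /phi mulr_sumr; apply: eq_bigr => i _; rewrite mxE rmorphM mulrA.
  have phi0 : phi 0 = 0.
    by rewrite /phi big1 // => i _; rewrite mxE rmorph0 mul0r.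
  rewrite (big_morph phi phiD phi0); apply: eq_bigr => k _.
  by rewrite phiZ rowK phi_iter mulrA.
have /esym/eqP : 0 = phi m * phi v.
  by rewrite -phiE mE /phi big1 // => i _; rewrite mxE rmorph0 mul0r.
rewrite mulf_eq0 => /orP [] /eqP /phi_eq0; last by move=> ->.
by move=> m00; rewrite m00 eqxx in m0.
Qed.

(** The generic matrix is irreducible over the field generated by its entries
    and their derivatives: no nonzero vector lies in a proper stable subspace.
    Adding to it a large multiple of the companion matrix of [y ^+ n] over
    [K[y ^+ n]], the leading terms reduce this to the latter. *)
Lemma generic_cyclic (w : 'rV[K]_n) :
  w != 0 -> krylov (fun=> 0) A w \in unitmx.
Proof.
move=> w0; rewrite unitmxE unitfE; apply/negP => /eqP det0.
pose j : {rmorphism F -> {poly {poly K}}} := polyC \o (polyC \o iota).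
pose b u : {poly {poly K}} := (jet u)%:P%:P +
  (if u.2 == 0%N then C u.1.1 u.1.2 else 0) *: 'X.
pose G := teval_rel iota j jet b.
have gG : graded_rel (fun=> G) by exact: graded_teval_rel.
have G0 x y : G x y -> x = 0 -> y = 0.
  by move=> [t -> ->]; exact: alg_indep_teval.
have Gx x y : G x y -> y`_0 = x%:P.
  move=> [t -> ->]; elim: t => [c|u|t1 e1 t2 e2|t1 e1 t2 e2] /=.
  - by rewrite coefC.
  - by rewrite coefD coefC coefZ coefX mulr0 addr0.
  - by rewrite coefD e1 e2 polyCD.
  - by rewrite coef0M e1 e2 polyCM.
have [g [p [g0 gp]]] : exists g (p : 'rV_n), g != 0 /\
    forall i, G (g * w 0 i) (p 0 i).
  have /choice [f fP] i : exists f, teval iota jet f.2 != 0 /\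
      w 0 i = teval iota jet f.1 / teval iota jet f.2.
    by have [t [t' h]] := generated_by_frac ag (w 0 i); exists (t, t').
  exists (\prod_i teval iota jet (f i).2).
  exists (\row_i (teval j b (f i).1 * \prod_(l | l != i) teval j b (f l).2)).
  split=> [|i]; first by apply/prodf_neq0 => i _; case: (fP i).
  have [fi wE] := fP i; rewrite mxE (bigD1 i) //= wE.
  rewrite [X in G X]mulrC mulrA divfK //.
  apply: (gradedM gG (e := 0) (e' := 0)); first by exists (f i).1.
  by apply: (@graded_prod _ _ _ gG _ _ _ (fun=> 0)) => l _; exists (f l).2.
pose B : 'M[{poly {poly K}}]_n := \matrix_(i, l) b (i, l, 0%N).
have detB : \det (krylov (fun=> 0) B p) = 0.
  apply: (G0 (\det (krylov (fun=> 0) A (g *: w)))); last first.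
    rewrite (_ : krylov _ _ _ = g *: krylov (fun=> 0) A w).
      by rewrite detZ det0 mulr0.
    by apply/matrixP => i l; rewrite !mxE !iter_nabla0 -scalemxAl !mxE.
  apply: (@graded_det _ _ _ gG _ (fun=> 0)) => i l; rewrite !mxE.
  apply: (graded_iter_nabla gG (e := 0)) => [e x y _|i' l'|l'].
  - exact: (graded0 gG 0).
  - by rewrite mxE; exists (TVar (i', l', 0%N)).
  - by rewrite mxE.
pose e := (\max_i (size (p 0%R i)).-1)%N.
pose p0 : 'rV[{poly K}]_n := \row_i (p 0 i)`_e.
have pe i : top_coef e (p 0 i) (p0 0 i).
  rewrite mxE; apply: top_coef_size; apply: leq_trans (leqSpred _) _.
  by rewrite ltnS; exact: leq_bigmax.
have gT := graded_top_coef {poly K}.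
suff p00 : p0 != 0.
  have /negP := companion_cyclic p00; apply; apply/eqP.
  suff : top_coef (\sum_(i < n) (e%:Z + i%:Z)) (\det (krylov (fun=> 0) B p))
    (\det (krylov (fun=> 0) C p0)) by rewrite detB; exact: top_coef0.
  apply: (@graded_det _ _ _ gT _ (fun i => e%:Z + i%:Z)) => i l.
  rewrite [krylov _ B p _ _]mxE [krylov _ C p0 _ _]mxE.
  apply: (graded_iter_nabla gT) => // [e1 x y _|i' l']; first exact: (graded0 gT).
  rewrite mxE /b /=; split=> [[|[|m]] // _|] /=; rewrite coefD coefC coefZ coefX.
    by rewrite mulr0 addr0.
  by rewrite mulr1 add0r.
have [i wi] : exists i, p 0 i != 0.
  have /rV0Pn [i wi] := w0; exists i; apply: contra_neq wi => pi.
  have := Gx _ _ (gp i); rewrite pi coef0 => /esym /eqP.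
  by rewrite polyC_eq0 mulf_eq0 (negPf g0) => /eqP.
have [i0 i0P] : exists i0, e = (size (p 0 i0)).-1.
  have [|i0 eE] := @bigop.eq_bigmax _ (fun i : 'I_n => (size (p 0%R i)).-1).
    by rewrite card_ord.
  by exists i0; rewrite -eE.
apply/rV0Pn; have [z|nz] := eqVneq (p 0 i0) 0; last first.
  by exists i0; rewrite mxE i0P -lead_coefE lead_coef_eq0.
have e0 : e = 0%N by rewrite i0P z size_poly0.
exists i; rewrite mxE.
suff -> : e = (size (p 0 i)).-1 by rewrite -lead_coefE lead_coef_eq0.
have : ((size (p 0%R i)).-1 <= e)%N by exact: leq_bigmax.
by rewrite e0 leqn0 => /eqP.
Qed.

End GenericMatrix.

(** * The differentials of the companion coefficients *)

Section CompanionCoefficients.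
Variables (F K : fieldType) (dF : F -> F) (iota : {rmorphism F -> K}).
Variables (d : K -> K) (n' : nat).
Let n := n'.+1.
Variable A : 'M[K]_n.
Hypothesis hd : derivation d.
Hypothesis hiota : diff_morphism dF d iota.
Let U : Type := ('I_n * 'I_n * nat)%type.
Let jA : U -> K := jet d A.
Hypothesis ai : alg_indep iota jA.
Hypothesis ag : generated_by iota jA.

Lemma exists_partials : exists P : U -> K -> K,
  (forall u, lin_derivation iota (P u)) /\
  forall u v, P u (jA v) = (u == v)%:R.
Proof.
have /choice [P hP] u : exists D, lin_derivation iota D /\
    forall v, D (jA v) = (u == v)%:R.
  by have [D hD DE] := exists_lin_derivation ai ag (fun v => (u == v)%:R); exists D.
by exists P; split=> u; case: (hP u).
Qed.

Variable P : U -> K -> K.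
Hypothesis hP : forall u, lin_derivation iota (P u).
Hypothesis PE : forall u v, P u (jA v) = (u == v)%:R.

(** The Kaehler differential of [x] over [F], in its coordinates on the basis
    formed by the differentials of the generators. *)
Definition differential (x : K) : U -> K^o := fun u => P u x.

(** The semilinear map induced by [d] on differentials; [d] sends the generator
    of order [k] to the one of order [k.+1], whence the shift. *)
Definition dder (w : U -> K^o) : U -> K^o :=
  fun u => d (w u) + (if u.2 is k.+1 then w (u.1, k) else 0).

Lemma dderD : {morph dder : v w / v + w}.
Proof.
move=> v w; apply/funext => -[ij [|k]].
  by rewrite !addrfctE /dder /= hd.1 !addr0.
by rewrite !addrfctE /dder /= hd.1 addrACA.
Qed.

Lemma dderZ c w : dder (c *: w) = d c *: w + c *: dder w.
Proof.
by apply/funext => -[ij [|k]]; rewrite addrfctE !scalrfctE /dder /= hd.2;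
  rewrite /GRing.scale /=; ring.
Qed.

Lemma differential_der x : differential (d x) = dder (differential x).
Proof.
apply/funext => u; apply/eqP; rewrite -subr_eq0; apply/eqP.
pose D x := differential (d x) u - dder (differential x) u.
rewrite -[LHS]/(D x); apply: (lin_derivation_eq0 ag) => [|v].
  split=> [|c]; last first.
    rewrite /D /dder /differential -hiota !(hP _).2 der0 // sub0r add0r.
    by case: u D => ij [|k] _ /=; rewrite ?(hP _).2 oppr0.
  have hDu y : derivation (P y) by case: (hP y).
  rewrite /D /dder /differential; split=> y z.
    rewrite !(hd.1, (hDu _).1); case: u D => ij [|k] _ /=; first by ring.
    by rewrite (hDu _).1; ring.
  rewrite !(hd.1, hd.2, (hDu _).1, (hDu _).2).
  by case: u D => ij [|k] _ /=; rewrite ?(hDu _).2; ring.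
have Pd w ij k : P w (d (jA (ij, k))) = (w == (ij, k.+1))%:R.
  by rewrite -PE.
case: v => ij l; rewrite /D /dder /differential Pd PE (der_bool hd) add0r.
case: u D => ij' [|k] _ /=; first by rewrite xpair_eqE andbF subrr.
by rewrite PE !xpair_eqE eqSS subrr.
Qed.

Lemma differential_iter k x :
  differential (iter k d x) = iter k dder (differential x).
Proof. by elim: k => //= k <-; rewrite differential_der. Qed.

(** The matrix entries have degree one and [d] preserves degrees, whereas
    partial derivatives lower them. *)
Lemma degree_derivation_d : degree_derivation iota jA 0 d.
Proof.
apply: degree_derivation_gen => // [c|[ij k]].
  rewrite -hiota; exists (iota (dF c))%:P; last by rewrite mulr1.
  by exists (TConst (dF c)).
exists (d (jA (ij, k)) *: 'X); last by rewrite mulr1.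
by exists (TVar (ij, k.+1)).
Qed.

Lemma degree_derivation_partial u : degree_derivation iota jA 1 (P u).
Proof.
have [hD Dc] := hP u; apply: degree_derivation_gen => // [c|v].
  exists 0; last by rewrite Dc mul0r.
  by exists (TConst 0); rewrite /= rmorph0.
exists (u == v)%:R%:P; last by rewrite PE mul_polyC.
exists (TConst (u == v)%:R); by rewrite /= ?PE rmorph_nat.
Qed.

Let e1 : 'rV[K]_n := delta_mx 0 0.

Let e1_neq0 : e1 != 0.
Proof. by apply/rV0Pn; exists 0; rewrite mxE !eqxx oner_neq0. Qed.

(** Up to sign, the coefficients of the characteristic polynomial of [A]. *)
Definition char_row : 'rV[K]_n := companion_row (fun=> 0) A e1.

Let Q := krylov (fun=> 0) A e1.

Let Qu : Q \in unitmx. Proof. exact: (generic_cyclic ai ag e1_neq0). Qed.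

(** A variation of [A] that vanishes on the vectors of the cyclic basis but the
    last one leaves this basis unchanged, and affects only the companion row. *)
Lemma char_row_der D (s : 'rV[K]_n) : derivation D ->
  Q *m map_mx D A = \matrix_k (if k == ord_max then s *m Q else 0) ->
  map_mx D char_row = s.
Proof.
move=> hD QE; pose v k := iter k (nabla (fun=> 0) A) e1.
have vS k : v k.+1 = v k *m A by rewrite /v !iter_nabla0 exprSr -mulmxE mulmxA.
have vQ (k : 'I_n) : v k *m map_mx D A = if k == ord_max then s *m Q else 0.
  by have := congr1 (row k) QE; rewrite row_mul !rowK.
have v0 k : (k < n)%N -> map_mx D (v k) = 0.
  elim: k => [|k IH] kn.
    by apply/matrixP => i j; rewrite !mxE -mulnb natrM hD.2 !(der_bool hD); ring.
  rewrite vS (der_mulmx hD) IH ?mul0mx ?add0r 1?ltnW //.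
  have := vQ (Ordinal (ltnW kn)); rewrite /= => ->.
  rewrite ifF //; apply/negbTE; rewrite -(inj_eq val_inj) /=; move: kn.
  by rewrite /n; lia.
have Q0 : map_mx D Q = 0.
  apply/row_matrixP => k; rewrite row0 -map_row rowK.
  exact: v0.
have : map_mx D (v n) = s *m Q.
  rewrite vS (der_mulmx hD) v0 // mul0mx add0r.
  by have := vQ ord_max; rewrite eqxx.
rewrite /v (iter_nabla_companion Qu) -/char_row -/Q (der_mulmx hD) Q0 mulmx0 addr0.
exact: (can_inj (mulmxK Qu)).
Qed.

Lemma char_row_partial ij k i : P (ij, k.+1) (char_row 0 i) = 0.
Proof.
have [hD _] := hP (ij, k.+1).
have := @char_row_der _ 0 hD; rewrite mul0mx => /(_ _)/matrixP /(_ 0 i).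
rewrite !mxE; apply; apply/matrixP => l m; rewrite !mxE if_same mxE big1 // => r _.
by rewrite [map_mx _ _ _ _]mxE -[A r m]/(jA (r, m, 0%N)) PE xpair_eqE andbF mulr0.
Qed.

(** A variation of [A] as in [char_row_der] gives the coefficients arbitrary
    derivatives. *)
Lemma char_row_partials_free (c : 'I_n -> K) :
  (forall ij, \sum_i c i * P (ij, 0%N) (char_row 0 i) = 0) -> forall i, c i = 0.
Proof.
move=> h i; pose s : 'rV[K]_n := delta_mx 0 i.
pose M : 'M[K]_n := invmx Q *m \matrix_k (if k == ord_max then s *m Q else 0).
pose D x := \sum_ij M ij.1 ij.2 * P (ij, 0%N) x.
have hD : derivation D.
  split=> x y; rewrite /D.
    rewrite -big_split; apply: eq_bigr => ij _ /=.
    by rewrite (hP _).1.1 mulrDr.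
  rewrite mulr_suml mulr_sumr -big_split; apply: eq_bigr => ij _ /=.
  by rewrite (hP _).1.2; ring.
have DA : map_mx D A = M.
  apply/matrixP => k l; rewrite mxE /D (bigD1 (k, l)) //= big1 => [|ij ne].
    by rewrite -[A k l]/(jA (k, l, 0%N)) PE eqxx mulr1 addr0.
  by rewrite -[A k l]/(jA (k, l, 0%N)) PE xpair_eqE (negPf ne) mulr0.
have Ds l : D (char_row 0 l) = (l == i)%:R.
  have : map_mx D char_row = s by apply: char_row_der => //; rewrite DA mulKVmx.
  by move=> /matrixP /(_ 0 l); rewrite [map_mx _ _ _ _]mxE => ->; rewrite mxE eqxx.
have : \sum_l c l * D (char_row 0 l) = 0.
  rewrite /D; under eq_bigr do rewrite mulr_sumr.
  rewrite exchange_big big1 //= => ij _.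
  transitivity (M ij.1 ij.2 * \sum_l c l * P (ij, 0%N) (char_row 0 l)).
    by rewrite mulr_sumr; apply: eq_bigr => l _; rewrite mulrCA.
  by rewrite h mulr0.
rewrite (bigD1 i) //= big1 => [|l li]; rewrite Ds.
  by rewrite eqxx mulr1 addr0.
by rewrite (negPf li) mulr0.
Qed.

Lemma partial_iter_der x i j k l :
  (forall m, P (i, j, m.+1) x = 0) -> (l <= k)%N ->
  P (i, j, k) (iter l d x) = (l == k)%:R * P (i, j, 0%N) x.
Proof.
move=> h; elim: l k => [|l IH] k lk.
  by case: k {lk} => [|k]; rewrite ?mul1r // h mul0r.
have /(congr1 (fun w => w (i, j, k))) := differential_der (iter l d x).
rewrite /differential /dder /= => ->; case: k lk => // k lk.
rewrite !IH //; last exact: ltnW.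
by rewrite eqSS (_ : (l == k.+1) = false) ?mul0r ?der0 ?add0r //; lia.
Qed.

Section CyclicVector.
Variable v : 'rV[K]_n.
Hypothesis v0 : v != 0.

(** Among large matrices the derivative in [nabla] is negligible, and every
    vector is cyclic for the leading form of [A], which is [A] itself. *)
Lemma krylov_unit_leading : krylov d A v \in unitmx /\
  forall i : 'I_n, leading_form iota jA (n%:Z - i%:Z)
    (companion_row d A v 0 i) (char_row 0 i).
Proof.
have gL := graded_leading_form iota jA.
have /rV0Pn [i0 vi0] := v0.
have [e [c [hc c0]]] := exists_leading_forms ai ag (fun=> 0) vi0.
pose w : 'rV[K]_n := \row_i c i.
have w0 : w != 0 by case: c0 => i ci; apply/rV0Pn; exists i; rewrite mxE.
have hv i : leading_form iota jA e (v 0 i) (w 0 i).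
  by rewrite mxE; have := hc i; rewrite subr0.
have hit k i : leading_form iota jA (e + k%:Z) (iter k (nabla d A) v 0 i)
    (iter k (nabla (fun=> 0) A) w 0 i).
  apply: (graded_iter_nabla gL) => // [f x y h|i1 i2].
    have := leading_form_der degree_derivation_d h; rewrite subr0.
    by apply: leading_form_lt; rewrite ltrDl.
  exact: (leading_form_gen iota jA (i1, i2, 0%N)).
have Wu : krylov (fun=> 0) A w \in unitmx by exact: (generic_cyclic ai ag w0).
have hK (i j : 'I_n) : leading_form iota jA (e + i%:Z)
    (krylov d A v i j) (krylov (fun=> 0) A w i j) by rewrite !mxE.
have hI i j := leading_form_invmx ai (e := fun i : 'I_n => e + i%:Z) i j hK Wu.
split; first by case: (hI 0 0).
move=> i; rewrite /char_row (companion_row0 Qu Wu) /companion_row !mxE.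
apply: (graded_sum gL) => j _.
rewrite (_ : n%:Z - i%:Z = (e + n%:Z) + - (e + i%:Z)); last by ring.
by apply: (gradedM gL); [exact: hit | case: (hI j i)].
Qed.

(** A relation between the differentials of the companion coefficients would,
    in its leading terms, be one between those of the characteristic
    coefficients. *)
Lemma companion_row_indep :
  op_indep dder setT (fun i => differential (companion_row d A v 0 i)).
Proof.
have gL := graded_leading_form iota jA.
have [_ hb] := krylov_unit_leading; set b := companion_row d A v in hb *.
move=> N c rel; apply: contrapT => /existsNP [j0] /existsNP [k0].
move=> /not_implyP [_] /not_implyP [k0N /eqP c0].
have relu u : \sum_(i < n) \sum_(k < N) c i k * P u (iter k d (b 0 i)) = 0.
  transitivity ((\sum_(i in setT) \sum_(k < N)
    c i k *: iter k dder (differential (b 0 i))) u); last by rewrite rel.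
  rewrite fct_sumE; apply: eq_big => [i|i _]; rewrite ?inE // fct_sumE.
  by apply: eq_bigr => k _; rewrite -differential_iter.
pose wt (ik : 'I_n * 'I_N) := n%:Z - ik.1%:Z.
pose x (ik : 'I_n * 'I_N) := c ik.1 ik.2.
have [e [m [hm [ik mik]]]] :=
  @exists_leading_forms _ _ _ _ _ ai ag _ wt x (j0, Ordinal k0N) c0.
(* Only leading terms survive in degree [e - 1]: the weight of [(i, k)] makes up
   for the degree [n - i] of the coefficient [i], and partial derivatives lose
   one degree. *)
have relm u : \sum_(i < n) \sum_(k < N) m (i, k) * P u (iter k d (char_row 0 i)) = 0.
  apply: (leading_form_eq0 ai) (relu u) => //.
  apply: (@graded_sum _ _ _ gL _ _ _ (e - 1)) => i _.
  apply: (graded_sum gL) => k _.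
  rewrite (_ : e - 1 = (e - wt (i, k)) + (n%:Z - i%:Z - 1%:Z)).
    apply: (gradedM gL); first exact: (hm (i, k)).
    apply: (leading_form_der (degree_derivation_partial u)).
    elim: (k : nat) => [|l IH]; first exact: hb.
    by have := leading_form_der degree_derivation_d IH; rewrite subr0.
  by rewrite /wt /=; ring.
(* At the highest order [k1], the partial derivative along the generators of
   order [k1] only sees the differentials of the coefficients themselves. *)
case: (@arg_maxnP _ ik (fun ik => m ik != 0) (fun ik => ik.2)) => // -[i1 k1] /= m1 max1.
suff e0 i : m (i, k1) = 0 by rewrite e0 eqxx in m1.
move: i; apply: char_row_partials_free => -[p q].
rewrite -[RHS](relm (p, q, k1 : nat)); apply: eq_bigr => i _.
rewrite (bigD1 k1) //= partial_iter_der ?eqxx ?mul1r //; last first.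
  by move=> l; exact: char_row_partial.
rewrite big1 ?addr0 // => k kk.
have [->|mk] := eqVneq (m (i, k)) 0; first by rewrite mul0r.
rewrite partial_iter_der; last exact: (max1 (i, k)).
  by rewrite val_eqE (negPf kk) mul0r mulr0.
by move=> l; exact: char_row_partial.
Qed.

End CyclicVector.

End CompanionCoefficients.

(** * Counting parameters *)

Section GaugeClass.
Variables (F K : fieldType) (dF : F -> F) (iota : {rmorphism F -> K}).
Variables (d : K -> K) (n' : nat).
Let n := n'.+1.
Variable A : 'M[K]_n.
Hypothesis charF : [pchar F] =i pred0.
Hypothesis hd : derivation d.
Hypothesis hiota : diff_morphism dF d iota.
Hypothesis ai : alg_indep iota (jet d A).
Hypothesis ag : generated_by iota (jet d A).

Let e1 : 'rV[K]_n := delta_mx 0 0.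

Let e1_neq0 : e1 != 0.
Proof. by apply/rV0Pn; exists 0; rewrite mxE !eqxx oner_neq0. Qed.

Section Differentials.
Variable P : 'I_n * 'I_n * nat -> K -> K.
Hypothesis hP : forall u, lin_derivation iota (P u).
Hypothesis PE : forall u v, P u (jet d A v) = (u == v)%:R.

Local Notation dd := (dder d (n' := n')).
Local Notation df := (differential P).

Lemma differentialD : {morph df : x y / x + y}.
Proof. by move=> x y; apply/funext => u; rewrite addrfctE /differential (hP u).1.1. Qed.

Lemma differentialM x y : df (x * y) = x *: df y + y *: df x.
Proof.
apply/funext => u; rewrite addrfctE !scalrfctE /differential (hP u).1.2.
by rewrite /GRing.scale /=; ring.
Qed.

Lemma differential0 : df 0 = 0.
Proof. by apply: (addrI (df 0)); rewrite -differentialD !addr0. Qed.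

Lemma differential_mulmx (v : 'rV[K]_n) (B : 'M[K]_n) j :
  df ((v *m B) 0 j) = \sum_i v 0 i *: df (B i j) + \sum_i B i j *: df (v 0 i).
Proof.
rewrite mxE (big_morph df differentialD differential0) -big_split.
by apply: eq_bigr => i _; exact: differentialM.
Qed.

Lemma op_indep_diff_indep (B : 'M[K]_n) (S : {set 'I_n * 'I_n}) :
  op_indep dd S (fun ij => df (B ij.1 ij.2)) ->
  entries_diff_indep iota d B S.
Proof.
move=> ind; apply: (jacobian_alg_indep charF hP) => k s c s_inj rel i0.
pose N := (\max_i (s i).2).+1.
have sN i : ((s i).2 < N)%N by rewrite ltnS (leq_bigmax i).
pose c' ij l := \sum_(i | (val (s i).1 == ij) && ((s i).2 == l)) c i.
have <- : c' (val (s i0).1) (s i0).2 = c i0.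
  rewrite /c' (bigD1 i0) ?eqxx //= big1 ?addr0 // => i /andP [/andP [/eqP e1' /eqP e2']].
  case/negP; apply/eqP/s_inj; case: (s i) (s i0) e1' e2' => [u l] [u' l'] /= e e'.
  by rewrite e' (val_inj e).
apply: (ind N) => //; last exact: valP.
transitivity (\sum_i c i *: df (iter (s i).2 d (B (val (s i).1).1 (val (s i).1).2))).
  rewrite (partition_big (fun i => val (s i).1) (mem S)) /=; last first.
    by move=> i _; exact: valP.
  apply: eq_bigr => ij _.
  rewrite (partition_big (fun i => Ordinal (sN i)) xpredT) //=.
  apply: eq_bigr => l _; rewrite scaler_suml; apply: eq_big => [i|i].
    by rewrite -val_eqE.
  by case/andP => /eqP <- /eqP <-; rewrite (differential_iter hd hiota ag hP PE).
apply/funext => u; rewrite fct_sumE -[RHS](rel u).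
by apply: eq_bigr.
Qed.

Lemma nabla_in_jets (B : 'M[K]_n) k j :
  in_span (jets dd (fun ij => df (B ij.1 ij.2)) setT k)
    (df (iter k (nabla d B) e1 0 j)).
Proof.
have dd_der x := differential_der hd hiota ag hP PE x.
elim: k j => [|k IH] j /=.
  rewrite mxE (_ : df _ = 0); first exact: in_span0.
  by apply/funext => u; rewrite /differential (der_bool (hP u).1).
have IHs i : in_span (jets dd (fun ij => df (B ij.1 ij.2)) setT k.+1)
    (df (iter k (nabla d B) e1 0 i)).
  apply: in_span_trans (IH i) => w /jetsP [ij [l [_ lk ->]]].
  by apply: mem_in_span; rewrite mem_jets ?inE // ltnW.
rewrite mxE differentialD; apply: in_spanD.
  rewrite mxE dd_der.
  by have := iter_in_span_jets (dderD hd) (dderZ hd) 1 (IH j); rewrite addn1.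
rewrite differential_mulmx; apply: in_spanD; apply: in_span_sum => i _.
  apply: in_spanZ; apply: mem_in_span.
  exact: (@mem_jets _ _ dd _ _ _ k.+1 (i, j) 0).
exact/in_spanZ/IHs.
Qed.

(** The companion coefficients belong to the differential field generated by the
    entries of [B], whose rank is thus at least [n]. *)
Lemma gauge_equiv_rank (B : 'M[K]_n) : gauge_equiv d A B ->
  exists2 S, entries_diff_indep iota d B S & (n <= #|S|)%N.
Proof.
move=> [T Tu BE]; pose v := e1 *m T.
have v0 : v != 0.
  by apply: contra_neq e1_neq0 => v0; rewrite -(mulmxK Tu e1) -/v v0 mul0mx.
have [Qu _] := krylov_unit_leading hd hiota ai ag v0.
pose b := companion_row d A v; pose R := krylov d B e1.
have RT : R *m T = krylov d A v.
  by apply/row_matrixP => k; rewrite row_mul !rowK (iter_nabla_gauge hd _ _ Tu BE).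
have Ru : R \in unitmx by move: Qu; rewrite -RT unitmx_mul => /andP [].
have rE : iter n (nabla d B) e1 = b *m R.
  apply: (can_inj (mulmxK Tu)); rewrite (iter_nabla_gauge hd _ _ Tu BE) -/v.
  by rewrite (iter_nabla_companion Qu) -[RHS]mulmxA RT.
have [S Si nS] : exists2 S : {set 'I_n * 'I_n},
    op_indep dd S (fun ij => df (B ij.1 ij.2)) & (n <= #|S|)%N.
  apply: (op_rank_le (dderD hd) (dderZ hd) (h := n)
    (companion_row_indep hd hiota ai ag hP PE v0)) => l.
  rewrite -/b; set s := jets _ _ _ _.
  have dR (i : 'I_n) j : in_span s (df (R i j)).
    rewrite mxE; apply: in_span_trans (nabla_in_jets B i j) => w.
    move=> /jetsP [ij [m [_ mi ->]]]; apply: mem_in_span.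
    by rewrite mem_jets ?inE // (ltn_trans mi).
  (* Differentiating [r = b R] gives the differential of [b] without expanding
     the inverse of [R]. *)
  have dbR j : in_span s (\sum_i R i j *: df (b 0 i)).
    have := differential_mulmx b R j; rewrite -rE => /eqP.
    rewrite addrC -subr_eq => /eqP <-; rewrite -scaleN1r.
    apply: in_spanD; first exact: nabla_in_jets.
    by apply: in_spanZ; apply: in_span_sum => i _; apply: in_spanZ.
  have -> : df (b 0 l) = \sum_j invmx R j l *: \sum_i R i j *: df (b 0 i).
    under eq_bigr do rewrite scaler_sumr.
    rewrite exchange_big (bigD1 l) //= [X in _ + X]big1 ?addr0 => [|i il];
      under eq_bigr do rewrite scalerA mulrC;
      rewrite -scaler_suml; have /matrixP := mulmxV Ru.
      by move=> /(_ l l); rewrite [LHS]mxE [RHS]mxE eqxx => ->; rewrite scale1r.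
    by move=> /(_ i l); rewrite [LHS]mxE [RHS]mxE (negPf il) => ->; rewrite scale0r.
  by apply: in_span_sum => j _; apply: in_spanZ.
by exists S; first exact: op_indep_diff_indep.
Qed.

End Differentials.

Lemma num_params_ge (B : 'M[K]_n) :
  gauge_equiv d A B -> (n <= num_params iota d B)%N.
Proof.
have [P [hP PE]] := exists_partials ai ag.
move=> /(gauge_equiv_rank hP PE) [S Si nS]; apply: leq_trans nS _.
by apply: (bigop.leq_bigmax_cond (F := fun S : {set _} => #|S|)); apply/asboolP.
Qed.

(** An entry coming from the base field is not a parameter. *)
Lemma entries_diff_indep_const (B : 'M[K]_n) S ij c :
  entries_diff_indep iota d B S -> B ij.1 ij.2 = iota c -> ij \notin S.
Proof.
move=> ind Bc; apply/negP => ijS.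
pose s (_ : 'I_1) := (exist (fun ij => ij \in S) ij ijS, 0%N).
have /(_ _ _) := ind 1%N s ('X_ord0 - c%:MP).
rewrite mmapB mmapC mmapX mmap1U /= Bc subrr => /(_ _ erefl) X0.
have /X0 /(congr1 (mcoeff U_(ord0))) : injective s by move=> i i'; rewrite !ord1.
rewrite mcoeffB mcoeffX mcoeffC eqxx mcoeff0 mnm1_eq0 mulr0 subr0 => /eqP.
by rewrite oner_eq0.
Qed.

Lemma companion_gauge : exists2 B, gauge_equiv d A B & (num_params iota d B <= n)%N.
Proof.
have [Qu _] := krylov_unit_leading hd hiota ai ag e1_neq0.
set Q := krylov d A e1 in Qu.
pose B := Q *m A *m invmx Q + map_mx d Q *m invmx Q.
have rowB (k k' : 'I_n) : k' = k.+1 :> nat -> row k B = delta_mx 0 k'.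
  move=> kk'; have : row k (Q *m A + map_mx d Q) = row k' Q.
    rewrite raddfD /= row_mul -map_row !rowK kk' /nabla iterS addrC //.
  move=> /(congr1 (mulmx^~ (invmx Q))).
  by rewrite -!row_mul mulmxV // mulmxDl row1.
exists B; first by exists Q.
apply/bigop.bigmax_leqP => S /asboolP Si.
rewrite -[X in (_ <= X)%N](_ : #|[set (@ord_max n', j) | j in 'I_n]| = _); last first.
  by rewrite card_imset ?card_ord // => j j' [].
apply/subset_leq_card/subsetP => -[k j] kjS.
have [->|km] := eqVneq k ord_max; first exact: imset_f.
have k1 : (k.+1 < n)%N.
  by move: km; rewrite -(inj_eq val_inj) /= /n; have := ltn_ord k; rewrite /n; lia.
have /rowP /(_ j) := rowB k (Ordinal k1) erefl; rewrite [LHS]mxE [RHS]mxE eqxx /= => Bkj.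
have := @entries_diff_indep_const B S (k, j) (j == Ordinal k1)%:R Si.
by rewrite rmorph_nat Bkj kjS => /(_ erefl).
Qed.

End GaugeClass.

(** * The number of parameters *)

Theorem theorem1 (F : fieldType) (dF : F -> F) (hdF : derivation dF)
    (charF : [pchar F] =i pred0)
    (n : nat) (hn : (1 <= n)%N)
    (K : fieldType) (dK : K -> K) (hdK : derivation dK)
    (iota : {rmorphism F -> K}) (hiota : diff_morphism dF dK iota)
    (A : 'M[K]_n) (hA : general_matrix iota dK A) :
  is_gamma iota dK A n.
Proof.
case: n hn A hA => // n' _ A [ai ag].
have {}ai : alg_indep iota (jet dK A) by [].
have {}ag : generated_by iota (jet dK A) by [].
have ge := num_params_ge charF hdK hiota ai ag.
split; last by move=> k [B /ge nB <-].
have [B AB Bn] := companion_gauge hdK hiota ai ag.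
by exists B => //; apply/eqP; rewrite eqn_leq Bn ge.
Qed.
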